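(* Let $n\ge2$ and let $\mathcal{F}=\{f_1,\ldots,f_n\}$, $f_i\in(\mathbb{C}^* )^{A_i}$, be a generic collection of Laurent polynomials with $\mathcal{I}(\mathcal{F})$ compact. Let $K$ be a connected component of $\mathcal{I}(\mathcal{F})$ and $P_K$ the corresponding intersection polytope. If $p$ and $q$ are distinct vertices of $P_K$, then $\mathrm{ord}_{\mathcal{F}}(p)\neq\mathrm{ord}_{\mathcal{F}}(q)$. In particular, $\mathrm{ord}_{\mathcal{F}}$ is injective on the vertex set of $P_K$.
   Context: Amoeba $\mathcal{A}(f)=\mathrm{Log}|\mathcal{V}(f)|\subseteq\mathbb{R}^n$ with $\mathrm{Log}|(z_1,\ldots,z_n)|=(\log|z_1|,\ldots,\log|z_n|)$; $\mathrm{New}(f)$ = convex hull of support; $(\mathbb{C}^* )^A$ = Laurent polynomials with support exactly $A\subseteq\mathbb{Z}^n$. Components of $\mathbb{R}^n\setminus\mathcal{A}(f)$ are convex, and the order map $\mathbf{w}\mapsto\big(\frac{1}{(2\pi i)^n}\int_{\mathrm{Log}|\mathbf{z}|=\mathbf{w}}\frac{z_j\partial_jf}{f}\frac{dz_1\cdots dz_n}{z_1\cdots z_n}\big)_{j=1}^n$ assigns to each component a distinct point of $\mathrm{New}(f)\cap\mathbb{Z}^n$; $E_\alpha(f)$ denotes the component of order $\alpha$. Genericity: $\mathcal{F}$ is generic if (1) each $f_j$ is irreducible; (2) for every $k$-subset $\{f_{i_1},\ldots,f_{i_k}\}$, $\bigcap_\ell\partial\mathcal{A}(f_{i_\ell})$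 has codimension $k$; (3) for every $p\in\bigcap_j\mathcal{A}(f_j)$ and $\ell$ with $p\in\partial\mathcal{A}(f_\ell)$, there is a unique component of $\mathbb{R}^n\setminus\mathcal{A}(f_\ell)$ containing $p$ in its closure. $\mathcal{I}(\mathcal{F})=\bigcap_{j=1}^n\mathcal{A}(f_j)$; $V(\mathcal{F})=\bigcap_{j=1}^n\partial\mathcal{A}(f_j)$ (vertices of $\mathcal{I}(\mathcal{F})$); for a connected component $K$, $V(K)=K\cap V(\mathcal{F})$ and the intersection polytope is $P_K=\mathrm{conv}(V(K))$. Generalized order map: a boundary point $p$ of $\mathcal{A}(f_i)$ lying in the closure of a unique component $E_\alpha(f_i)$ gets $\mathrm{ord}_i(p):=\alpha$ (and $\mathrm{ord}_i$ is the usual order map off $\mathcal{A}(f_i)$). By genericity every $p\in V(\mathcal{F})$ has this property for every $i$, and $\mathrm{ord}_{\mathcal{F}}:V(\mathcal{F})\to\mathbb{Z}^{n\times n}$ sends $p$ to the matrix with rows $\mathrm{ord}_1(p),\ldots,\mathrm{ord}_n(p)$. *)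

(* Defs.v *)
From HB Require Import structures.
From mathcomp Require Import all_boot all_order all_algebra.
From mathcomp Require Import finmap.
From mathcomp Require Import complex.
From mathcomp Require Import all_classical all_reals all_analysis.

Set Implicit Arguments.
Unset Strict Implicit.
Unset Printing Implicit Defensive.

Import Order.TTheory GRing.Theory Num.Theory.
Import numFieldNormedType.Exports.

Local Open Scope classical_set_scope.
Local Open Scope complex_scope.
Local Open Scope ring_scope.

Section ConvexSets.
Context {R : realType} {n : nat}.

Definition convex_hull (S : set 'rV[R]_n) : set 'rV[R]_n :=
  smallest (@convex_set R 'rV[R]_n) S.

Definition extreme_points (P : set 'rV[R]_n) : set 'rV[R]_n :=
  [set p | P p /\
    forall x y (t : R), P x -> P y -> 0 < t < 1 ->
      p = t *: x + (1 - t) *: y -> x = y].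

End ConvexSets.

Section Dimension.
Context {R : realType} {n : nat}.

Definition unit_cube (d : nat) : set 'rV[R]_d :=
  [set x | forall j, 0 <= x 0 j <= 1].

(* By compactness of the cube such a phi is a homeomorphism onto its image. *)
Definition contains_cell (d : nat) (S : set 'rV[R]_n) : Prop :=
  exists phi : 'rV[R]_d -> 'rV[R]_n,
    [/\ {within @unit_cube d, continuous phi},
        {in @unit_cube d &, injective phi}
      & phi @` @unit_cube d `<=` S].

(* Topological dimension of a tame set: the largest d such that the set
   contains a d-cell.  Boundaries of amoebas become semialgebraic in the
   coordinates |z_j|, and for such sets this is the usual dimension. *)
Definition has_dimension (S : set 'rV[R]_n) (d : nat) : Prop :=
  contains_cell d S /\ ~ contains_cell d.+1 S.

(* The empty set has every codimension, as usual for transversality. *)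
Definition has_codimension (S : set 'rV[R]_n) (k : nat) : Prop :=
  S = set0 \/ exists2 d, has_dimension S d & (d + k = n)%N.

Definition boundary (S : set 'rV[R]_n) : set 'rV[R]_n :=
  closure S `\` interior S.

End Dimension.

(* Laurent polynomials in n variables, given by their finitely supported
   coefficient function; finsupp f is the support. *)
Definition laurent (R : realType) (n : nat) :=
  {fsfun 'rV[int]_n -> R[i] with 0}.

Section LaurentAlgebra.
Context {R : realType} {n : nat}.
Implicit Types f g h : laurent R n.

Definition laurent_mul g h (gamma : 'rV[int]_n) : R[i] :=
  \sum_(alpha <- finsupp g) g alpha * h (gamma - alpha).

Definition laurent_unit f : Prop :=
  exists g, forall gamma, laurent_mul f g gamma = (gamma == 0)%:R.

Definition laurent_irreducible f : Prop :=
  [/\ f <> [fsfun], ~ laurent_unit f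
    & forall g h, (forall gamma, f gamma = laurent_mul g h gamma) ->
        laurent_unit g \/ laurent_unit h].

Definition laurent_monomial (alpha : 'rV[int]_n) (z : 'rV[R[i]]_n) : R[i] :=
  \prod_(j < n) z 0 j ^ alpha 0 j.

Definition laurent_eval f (z : 'rV[R[i]]_n) : R[i] :=
  \sum_(alpha <- finsupp f) f alpha * laurent_monomial alpha z.

Definition laurent_partial_eval (j : 'I_n) f (z : 'rV[R[i]]_n) : R[i] :=
  \sum_(alpha <- finsupp f)
    (alpha 0 j)%:~R * f alpha * laurent_monomial (alpha - delta_mx 0 j) z.

End LaurentAlgebra.

Section Amoeba.
Context {R : realType} {n : nat}.
Implicit Types f : laurent R n.

Definition laurent_variety f : set 'rV[R[i]]_n :=
  [set z : 'rV[R[i]]_n | (forall j, z 0 j != 0) /\ laurent_eval f z = 0].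

Definition Log_abs (z : 'rV[R[i]]_n) : 'rV[R]_n :=
  \row_j ln (complex.Re `|z 0 j|).

Definition amoeba f : set 'rV[R]_n := Log_abs @` laurent_variety f.

Definition complement_component f (E : set 'rV[R]_n) : Prop :=
  exists2 w, (~` amoeba f) w & E = connected_component (~` amoeba f) w.

End Amoeba.

Section TorusIntegral.
Context {R : realType}.

Definition circle_point (r t : R) : R[i] := (r * cos t) +i* (r * sin t).

(* The contour integral of g(z) dz over the positively oriented circle
   |z| = r, with dz = i z dt. *)
Definition circle_integral (r : R) (g : R[i] -> R[i]) : R[i] :=
  let h t := g (circle_point r t) * ('i%C * circle_point r t) in
  (\int[lebesgue_measure]_(t in `[0, 2 * pi]) complex.Re (h t))
  +i* (\int[lebesgue_measure]_(t in `[0, 2 * pi]) complex.Im (h t)).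

Context {n : nat}.

Definition set_coord (z : 'rV[R[i]]_n) (j : 'I_n) (u : R[i]) : 'rV[R[i]]_n :=
  \row_k (if k == j then u else z 0 k).

Fixpoint iterated_circle_integral (s : seq 'I_n) (r : 'rV[R]_n)
    (g : 'rV[R[i]]_n -> R[i]) (z : 'rV[R[i]]_n) : R[i] :=
  if s is j :: s' then
    circle_integral (r 0 j)
      (fun u => iterated_circle_integral s' r g (set_coord z j u))
  else g z.

(* The integral of g(z) dz_1 ... dz_n over the torus Log|z| = w, as an
   iterated integral over its n circles; all coordinates of the starting
   point 0 are overwritten. *)
Definition torus_integral (w : 'rV[R]_n) (g : 'rV[R[i]]_n -> R[i]) : R[i] :=
  iterated_circle_integral (enum 'I_n) (\row_j expR (w 0 j)) g 0.

End TorusIntegral.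

Section Order.
Context {R : realType} {n : nat}.
Implicit Types (f : laurent R n) (w p : 'rV[R]_n) (E : set 'rV[R]_n).

Definition order_integral f w (j : 'I_n) : R[i] :=
  ((0 +i* (2 * pi)) ^+ n)^-1 *
  torus_integral w (fun z =>
    z 0 j * laurent_partial_eval j f z / laurent_eval f z
    / \prod_(k < n) z 0 k).

(* The integer vector whose entries are the order integrals; they are
   integers whenever w lies off the amoeba. *)
Definition order_map f w : 'rV[int]_n :=
  xget 0 [set alpha : 'rV[int]_n | forall j, (alpha 0 j)%:~R = order_integral f w j].

(* E is E_alpha(f). *)
Definition component_of_order f (alpha : 'rV[int]_n) E : Prop :=
  complement_component f E /\ forall w, E w -> order_map f w = alpha.

Definition adjacent_component f p E : Prop :=
  complement_component f E /\ closure E p.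

(* Off the amoeba, the usual order; at a boundary point, the order of the
   unique complement component having p in its closure (0 otherwise). *)
Definition generalized_order f p : 'rV[int]_n :=
  if `[< amoeba f p >] then
    xget 0 [set alpha : 'rV[int]_n |
      exists E, [/\ adjacent_component f p E,
        forall E', adjacent_component f p E' -> E' = E
      & component_of_order f alpha E]]
  else order_map f p.

End Order.

Section Systems.
Context {R : realType} {n : nat}.
Implicit Types F : 'I_n -> laurent R n.

Definition amoeba_intersection F : set 'rV[R]_n :=
  \bigcap_(i in [set: 'I_n]) amoeba (F i).

Definition intersection_vertices F : set 'rV[R]_n :=
  \bigcap_(i in [set: 'I_n]) boundary (amoeba (F i)).

Definition generic_system F : Prop :=
  [/\ forall i, laurent_irreducible (F i),
      forall S : {set 'I_n}, S != finset.set0 ->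
        has_codimension (\bigcap_(i in [set i | i \in S]) boundary (amoeba (F i)))
          #|S|
    & forall p (l : 'I_n), amoeba_intersection F p ->
        boundary (amoeba (F l)) p ->
        exists! E, adjacent_component (F l) p E].

Definition connected_component_of (X K : set 'rV[R]_n) : Prop :=
  exists2 x, X x & K = connected_component X x.

Definition intersection_polytope F (K : set 'rV[R]_n) : set 'rV[R]_n :=
  convex_hull (K `&` intersection_vertices F).

Definition system_order F (p : 'rV[R]_n) : 'M[int]_n :=
  \matrix_(i, j) generalized_order (F i) p 0 j.

End Systems.

(* Main.v *)
Require Import Defs.
From mathcomp Require Import all_boot all_order all_algebra.
From mathcomp Require Import finmap.
From mathcomp Require Import complex.
From mathcomp Require Import all_classical all_reals all_analysis.
From mathcomp Require Import ring lra zify.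

Set Implicit Arguments.
Unset Strict Implicit.
Unset Printing Implicit Defensive.

Import Order.TTheory GRing.Theory Num.Theory.
Import numFieldNormedType.Exports.

Local Open Scope classical_set_scope.
Local Open Scope ring_scope.

(* For a Laurent polynomial f and v in Z^n, the integer <v, order> at a point w
   off the amoeba is the number of zeros minus poles in the unit disc of
   u |-> f (u^v_1 z_1, ..., u^v_n z_n), for any z with Log |z| = w. Cauchy's
   formula is replaced by an average over the N-th roots of unity, since
   N^-1 * sum_(zeta^N = 1) zeta / (zeta - rho) = 1 / (1 - rho^N) tends to 1 if
   |rho| < 1 and to 0 if |rho| > 1. Comparing the number of zeros at w and w'
   along a rational direction shows that the segment between two points of equal
   order misses the amoeba; hence the complement components are the order
   classes, they are open and convex, and only finitely many occur.

   If p and q have equal orders, they lie in the closure of the same convex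
   components E_i, so the prolongation of [q, p] beyond p leaves every E_i and
   stays in K. Now K is contained in the hull of its vertices: at a point of K
   that misses some boundary, at most n - 1 of the convex components are
   adjacent, and a common kernel vector of their supporting functionals gives a
   segment of K centred at that point, so it is not farthest from the centre of
   any ball. Thus p is interior to a segment of the polytope. *)

(** * Convexity in row vectors *)

(** The order is given by Lebesgue integrals over a torus, whereas the geometry needs a count of
    zeros along a line. The two meet in [psi], the logarithmic derivative along v: its mean over the
    torus does not change when the angles are translated along v, so it is also the mean of the
    averages over N such translates, and these are uniformly close to the count. The count makes
    sense only for integral v, and the order records it only in the coordinate directions. Equality
    of orders passes to every integral v because the torus mean, unlike the count, is visibly linear
    in v. A perturbation can make a segment parallel to an integral vector because such directions
    are dense and the orders are locally constant. *)

Lemma sum_continuous (R : realType)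
    (T : topologicalType) (I : Type) (r : seq I) (P : pred I) (f : I -> T -> R) :
  (forall i, P i -> continuous (f i)) ->
  continuous (fun x => \sum_(i <- r | P i) f i x).
Proof. by move=> fl; apply: continuous_big => //; exact: (@add_continuous R^o). Qed.

Section RealContinuity.
Context {R : realType} {T : topologicalType}.
Implicit Types f g : T -> R.

Lemma contc (a : R) : continuous (fun _ : T => a).
Proof. exact: cst_continuous. Qed.

Lemma contD f g : continuous f -> continuous g -> continuous (fun x => f x + g x).
Proof. by move=> cf cg x; apply: (@continuousD _ R^o); [exact: cf|exact: cg]. Qed.

Lemma contN f : continuous f -> continuous (fun x => - f x).
Proof. by move=> cf x; apply: (@continuousN _ R^o); exact: cf. Qed.

Lemma contB f g : continuous f -> continuous g -> continuous (fun x => f x - g x).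
Proof. by move=> cf cg; apply: contD => //; exact: contN. Qed.

Lemma contM f g : continuous f -> continuous g -> continuous (fun x => f x * g x).
Proof. by move=> cf cg x; apply: continuousM; [exact: cf|exact: cg]. Qed.

End RealContinuity.

Lemma cont_comp {T U V : topologicalType} (f : T -> U) (g : U -> V) :
  continuous f -> continuous g -> continuous (fun x => g (f x)).
Proof. by move=> cf cg x; apply: (@continuous_comp _ _ _ f g); [exact: cf|exact: cg]. Qed.

Lemma rV_continuous (R : realType) (T : topologicalType) n (f : T -> 'rV[R]_n) :
  (forall i, continuous (fun x => f x 0 i)) -> continuous f.
Proof.
move=> cf x U [P nP sP].
have h : \forall y \near x, forall i, P 0 i (f y 0 i).
  by apply: filter_forall => i; apply: (cf i x); exact: nP.
apply: filterS h => y hy; apply: sP => i j; rewrite (ord1 i); exact: hy.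
Qed.

Section Dot.
Context {R : realType} {n : nat}.
Implicit Types u v x y : 'rV[R]_n.

Definition dot u v : R := \sum_i u 0 i * v 0 i.

Lemma dotC u v : dot u v = dot v u.
Proof. by apply: eq_bigr => i _; rewrite mulrC. Qed.

Lemma dotDl u v x : dot (u + v) x = dot u x + dot v x.
Proof. by rewrite -big_split; apply: eq_bigr => i _; rewrite !mxE mulrDl. Qed.

Lemma dotZl a u x : dot (a *: u) x = a * dot u x.
Proof. by rewrite mulr_sumr; apply: eq_bigr => i _; rewrite !mxE mulrA. Qed.

Lemma dotNl u x : dot (- u) x = - dot u x.
Proof. by rewrite -scaleN1r dotZl mulN1r. Qed.

Lemma dotDr u v x : dot x (u + v) = dot x u + dot x v.
Proof. by rewrite !(dotC x) dotDl. Qed.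

Lemma dotZr a u x : dot x (a *: u) = a * dot x u.
Proof. by rewrite !(dotC x) dotZl. Qed.

Lemma dotNr u x : dot x (- u) = - dot x u.
Proof. by rewrite !(dotC x) dotNl. Qed.

Lemma dotr0 u : dot u 0 = 0.
Proof. by apply: big1 => i _; rewrite mxE mulr0. Qed.

Lemma dot_sqD u v : dot (u + v) (u + v) = dot u u + 2 * dot u v + dot v v.
Proof. by rewrite dotDl !dotDr (dotC v u); ring. Qed.

Lemma dot_sqB u v : dot (u - v) (u - v) = dot u u - 2 * dot u v + dot v v.
Proof. by rewrite dot_sqD dotNl !dotNr opprK; ring. Qed.

Lemma dot_ge0 u : 0 <= dot u u.
Proof. by apply: sumr_ge0 => i _; rewrite -expr2 sqr_ge0. Qed.

Lemma dot_gt0 u : u != 0 -> 0 < dot u u.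
Proof.
move=> u0; rewrite lt_neqAle dot_ge0 andbT eq_sym; apply: contra u0.
rewrite psumr_eq0; last by move=> i _; rewrite -expr2 sqr_ge0.
move=> /allP h; apply/eqP/rowP => i; rewrite mxE.
by move: (h i (mem_index_enum i)); rewrite /= mulf_eq0 orbb => /eqP.
Qed.

Lemma coord_continuous_rV (i : 'I_n) : continuous (fun x : 'rV[R]_n => x 0 i).
Proof. exact: coord_continuous. Qed.

Lemma dot_continuous u : continuous (dot u).
Proof.
apply: (@sum_continuous _ _ _ _ _ (fun i x => u 0 i * x 0 i)) => i _ x.
by apply: continuousM; [exact: cst_continuous|exact: coord_continuous_rV].
Qed.

Lemma sqdist_continuous c : continuous (fun x => dot (x - c) (x - c)).
Proof.
apply: (@sum_continuous _ _ _ _ _ (fun i x => (x - c) 0 i * (x - c) 0 i)) => i _ x.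
have h : {for x, continuous (fun y : 'rV[R]_n => (y - c) 0 i)}.
  rewrite (_ : (fun y : 'rV[R]_n => _) = (fun y => y 0 i - c 0 i)); last first.
    by apply/funext => y; rewrite !mxE.
  by apply: continuousB; [exact: coord_continuous_rV|exact: cst_continuous].
exact: continuousM.
Qed.

(** The norm of row vectors is the maximum norm, attained at one coordinate, whose square is one
    term of the sum. This passes from Euclidean balls to boundedness. *)
Lemma norm_sqr_le_dot u : `|u| ^+ 2 <= dot u u.
Proof.
have [->|u0] := eqVneq u 0; first by rewrite normr0 expr0n /= dot_ge0.
have /mx_norm_neq0 [[i j] /= hij] : mx_norm u != 0.
  by rewrite -[mx_norm u]/`|u| normr_eq0.
rewrite (_ : `|u| = mx_norm u)// hij (ord1 i) real_normK ?num_real// /dot (bigD1 j)//= -expr2 lerDl.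
by apply: sumr_ge0 => k _; rewrite -expr2 sqr_ge0.
Qed.

Lemma closed_sqdist_le_compact (A : set 'rV[R]_n) (c : 'rV[R]_n) (r : R) :
  closed A -> compact (A `&` [set x | dot (x - c) (x - c) <= r]).
Proof.
move=> cA; apply: bounded_closed_compact; last first.
  apply: closedI => //.
  apply: (@preimage_closed _ _ _ [set t : R | t <= r]); last exact: closed_le.
  by move=> x _; exact: sqdist_continuous.
(* Since a <= 1 + a ^ 2, a bound r on the squared distance gives the bound 1 + r on the norm without
   a square root. *)
exists (`|c| + (1 + r)); split; first exact: num_real.
move=> M hM x [_ /= hx]; apply: le_trans (ltW hM).
have h : `|x - c| ^+ 2 <= r by apply: le_trans (norm_sqr_le_dot _) hx.
have -> : x = c + (x - c) by rewrite addrC subrK.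
apply: le_trans (ler_normD _ _) _; rewrite lerD2l.
have := sqr_ge0 (`|x - c| - 1); have := normr_ge0 (x - c); nra.
Qed.

End Dot.

Section ConvexSets.
Context {R : realType} {n : nat}.
Implicit Types (A C E S V : set 'rV[R]_n) (x y c m : 'rV[R]_n).

Lemma convex_setP A : @convex_set R 'rV[R]_n A <->
  forall x y (t : R), A x -> A y -> 0 <= t <= 1 -> A (t *: x + (1 - t) *: y).
Proof.
split=> [cA x y t Ax Ay t01|cA x y l].
  have h : Itv.spec (Itv.num_sem (R:=R)) (Itv.Real `[0%Z, 1%Z]) t.
    by rewrite /= /Itv.num_sem /= num_real /= in_itv.
  have := cA x y (Itv.mk h); rewrite !inE; exact.
rewrite !inE => Ax Ay; apply: cA => //.
by rewrite ge0 le1.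
Qed.

Lemma convex_hull_convex S : @convex_set R 'rV[R]_n (convex_hull S).
Proof.
apply/convex_setP => x y t Sx Sy t01 A [cA SA].
by move/convex_setP: (cA); apply => //; [exact: Sx|exact: Sy].
Qed.

Lemma sub_convex_hull S : S `<=` convex_hull S.
Proof. exact: sub_gen_smallest. Qed.

(** Removing an extreme point from a convex set leaves a convex set. Were p outside S, the hull
    without p would still be convex and contain S. *)
Lemma extreme_points_hull S : extreme_points (convex_hull S) `<=` S.
Proof.
move=> p [Qp ext]; apply: contrapT => Sp.
suff : (convex_hull S `\ p) p by case=> _ /=; apply.
apply: (Qp); split; last first.
  by move=> s Ss; split; [exact: sub_convex_hull|move=> /= sp; apply: Sp; rewrite -sp].
apply/convex_setP => x y t [Qx xp] [Qy yp] t01; split.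
  by have /convex_setP cv := @convex_hull_convex S; exact: cv.
move=> /= h.
have [t0|t0] := eqVneq t 0; first by apply: yp; rewrite /= -h t0 scale0r add0r subr0 scale1r.
have [t1|t1] := eqVneq t 1; first by apply: xp; rewrite /= -h t1 scale1r subrr scale0r addr0.
have xy : x = y.
  by apply: (ext x y t) => //; rewrite !lt_neqAle eq_sym t0 t1 /=.
by apply: xp; rewrite /= -h -xy -scalerDl addrC subrK scale1r.
Qed.

Lemma nearest_point C x : closed C -> @convex_set R 'rV[R]_n C -> C !=set0 -> ~ C x ->
  exists2 y, C y & forall c, C c -> dot (x - y) (c - y) <= 0.
Proof.
move=> cC /convex_setP vC [c0 Cc0] Cx.
have [|||y] := @compact_EVT_min _ R (fun z : 'rV[R]_n => dot (z - x) (z - x))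
   (C `&` [set z | dot (z - x) (z - x) <= dot (c0 - x) (c0 - x)]).
- by exists c0; split => //=.
- exact: closed_sqdist_le_compact.
- by apply: continuous_subspaceT; exact: sqdist_continuous.
rewrite inE => -[Cy /= yc0 ymin]; exists y => // c Cc.
have {}ymin z : C z -> dot (y - x) (y - x) <= dot (z - x) (z - x).
  move=> Cz; have [h|h] := leP (dot (z - x) (z - x)) (dot (c0 - x) (c0 - x)).
    by apply: ymin; rewrite inE.
  by apply: le_trans yc0 (ltW h).
rewrite leNgt; apply/negP => h.
have cy : 0 < dot (c - y) (c - y).
  apply: dot_gt0; apply: contraTneq h => ->.
  by rewrite dotr0 ltxx.
set a := dot (x - y) (c - y) in h; set b := dot (c - y) (c - y) in cy.
(* Moving from y towards c by t changes the squared distance by t (t b - 2 a). This t lies in [0, 1]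
   and satisfies t b < a, so the change is negative. *)
pose t := a / (a + b).
have ab : 0 < a + b by apply: addr_gt0.
have t01 : 0 <= t <= 1.
  by rewrite divr_ge0 ?(ltW h) ?(ltW ab)//= ler_pdivrMr// mul1r lerDl ltW.
have := ymin _ (vC c y t Cc Cy t01).
have -> : t *: c + (1 - t) *: y - x = (y - x) + t *: (c - y).
  by rewrite scalerBl scale1r scalerBr; apply/rowP => i; rewrite !mxE; ring.
rewrite (dot_sqD (y - x)) dotZl !dotZr -/b.
have -> : dot (y - x) (c - y) = - a by rewrite -opprB dotNl.
have tab : t * (a + b) = a by rewrite /t divfK// gt_eqF.
have t0 : 0 < t by apply: divr_gt0.
rewrite -addrA lerDl; nra.
Qed.

(** The map [g] sends z to the point whose segment to z passes through m in the given ratio. As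
    [g y] is x, the point [g z] stays in E for z near y, and some of these z lie in E. *)
Lemma open_convex_segment E x y t : open E -> @convex_set R 'rV[R]_n E ->
  E x -> closure E y -> 0 < t <= 1 -> E (t *: x + (1 - t) *: y).
Proof.
move=> oE /convex_setP vE Ex cEy /andP[t0 t1].
set m := t *: x + (1 - t) *: y.
pose g z : 'rV[R]_n := t^-1 *: (m - (1 - t) *: z).
have gy : g y = x by rewrite /g /m addrK scalerA mulVf ?gt_eqF// scale1r.
have cg : continuous g.
  apply: rV_continuous => i.
  rewrite (_ : (fun z => _) = (fun z : 'rV[R]_n => t^-1 * (m 0 i - (1 - t) * z 0 i))); last first.
    by apply/funext => z; rewrite !mxE.
  apply: contM; first exact: contc.
  apply: contB; first exact: contc.
  apply: contM; first exact: contc.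
  exact: coord_continuous_rV.
have : nbhs y (g @^-1` E) by apply: cg; rewrite gy; exact: open_nbhs_nbhs.
move=> /cEy [z [Ez Egz]].
have -> : m = t *: g z + (1 - t) *: z.
  by rewrite /g scalerA mulfV ?gt_eqF// scale1r subrK.
by apply: vE => //; rewrite ltW.
Qed.

Lemma closure_convex E : @convex_set R 'rV[R]_n E -> @convex_set R 'rV[R]_n (closure E).
Proof.
move=> /convex_setP vE; apply/convex_setP => x y t cx cy t01 U nU.
pose f (z : 'rV[R]_n * 'rV[R]_n) : 'rV[R]_n := t *: z.1 + (1 - t) *: z.2.
have cf : continuous f.
  apply: rV_continuous => i.
  rewrite (_ : (fun z => _) =
      (fun z : 'rV[R]_n * 'rV[R]_n => t * z.1 0 i + (1 - t) * z.2 0 i)); last first.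
    by apply/funext => z; rewrite !mxE.
  apply: contD; (apply: contM; first exact: contc);
    apply: (cont_comp _ (@coord_continuous_rV R n i)).
    by move=> z; exact: cvg_fst.
  by move=> z; exact: cvg_snd.
have /= [[U1 U2] /= [n1 n2] sU] := cf (x, y) U nU.
have [a [Ea Ua]] := cx _ n1; have [b [Eb Ub]] := cy _ n2.
exists (t *: a + (1 - t) *: b); split; first exact: vE.
by apply: (sU (a, b)).
Qed.

(* Carathéodory: a convex combination of more than n + 1 points has an affine
   dependence, along which one of the weights can be pushed to 0. *)
Lemma caratheodory N (v : 'I_N -> 'rV[R]_n) (l : 'I_N -> R) :
  (forall i, 0 <= l i) -> \sum_i l i = 1 ->
  exists (w : 'rV['rV[R]_n]_n.+1) (k : 'rV[R]_n.+1),
    [/\ forall j, exists i, w 0 j = v i, forall j, 0 <= k 0 j, \sum_j k 0 j = 1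
      & \sum_i l i *: v i = \sum_j k 0 j *: w 0 j].
Proof.
elim: N v l => [|N ih] v l l0 l1.
  by move: l1; rewrite big_ord0 => /eqP; rewrite eq_sym oner_eq0.
have [Nn|nN] := leqP N.+1 n.+1.
  (* With too few points, pad: an index j beyond N gets whatever point [inord j] names, with weight
     0. *)
  pose w := \row_(j < n.+1) v (inord j : 'I_N.+1).
  pose k := \row_(j < n.+1) (if (j < N.+1)%N then l (inord j : 'I_N.+1) else 0).
  exists w, k; split.
  - by move=> j; exists (inord j); rewrite mxE.
  - by move=> j; rewrite mxE; case: ifP.
  - under eq_bigr do rewrite mxE.
    rewrite -big_mkcond /= (big_ord_narrow Nn) -l1.
    by apply: eq_bigr => i _; rewrite /= inord_val.
  - rewrite (eq_bigr (fun j : 'I_n.+1 => if (j < N.+1)%N then l (inord j : 'I_N.+1) *: v (inord j) else 0)); last first.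
      by move=> j _; rewrite !mxE; case: ifP => // _; rewrite scale0r.
    rewrite -big_mkcond /= (big_ord_narrow Nn).
    by apply: eq_bigr => i _; rewrite /= inord_val.
(* Row i is [v i] preceded by 1, so a row vector killed by M is an affine dependence of the
   points. *)
pose M : 'M[R]_(N.+1, n.+1) := \matrix_(i, j) (if unlift ord0 j is Some j' then v i 0 j' else 1).
have [c cM c0] : exists2 c : 'rV[R]_N.+1, c *m M = 0 & c != 0.
  have : ~~ row_free M.
    by rewrite /row_free neq_ltn (leq_ltn_trans (rank_leq_col M)).
  rewrite -kermx_eq0 => /rowV0Pn [c /sub_kermxP cM c0].
  by exists c.
have sc : \sum_i c 0 i = 0.
  have /= h := congr1 (fun A : 'rV[R]_n.+1 => A 0 ord0) cM.
  rewrite !mxE in h; rewrite -[RHS]h.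
  by apply: eq_bigr => i _; rewrite !mxE unlift_none mulr1.
have scv : \sum_i c 0 i *: v i = 0.
  apply/rowP => j; rewrite summxE.
  have /= h := congr1 (fun A : 'rV[R]_n.+1 => A 0 (lift ord0 j)) cM.
  rewrite !mxE in h; rewrite mxE -[RHS]h.
  by apply: eq_bigr => i _; rewrite !mxE liftK.
have [i0 ci0] : exists i, 0 < c 0 i.
  apply: contrapT => /forallNP h; move: c0 => /negP; apply.
  have h' i : c 0 i <= 0 by have /negP := h i; rewrite -leNgt.
  apply/eqP/rowP => i; rewrite mxE; apply/eqP; rewrite eq_le h' /=.
  have := sc; rewrite (bigD1 i)//= => /eqP; rewrite addr_eq0 => /eqP ->.
  by rewrite oppr_ge0; apply: sumr_le0 => j _.
(* The smallest ratio is the largest multiple of c that can be subtracted while all weights stay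
   non-negative; it kills the weight of [i1]. *)
have [i1 ci1 hmin] : exists2 i1, 0 < c 0 i1 & forall i, 0 < c 0 i -> l i1 / c 0 i1 <= l i / c 0 i.
  case: (@arg_minP _ _ _ i0 (fun i => 0 < c 0 i) (fun i => l i / c 0 i) ci0) => i1 ? h.
  by exists i1.
pose t := l i1 / c 0 i1; pose l' i := l i - t * c 0 i.
have t0 : 0 <= t by apply: divr_ge0; [exact: l0|exact: ltW].
have l'0 i : 0 <= l' i.
  rewrite subr_ge0; have [ci|ci] := ltP 0 (c 0 i).
    by rewrite -ler_pdivlMr//; exact: hmin.
  by apply: le_trans (l0 i); rewrite mulr_ge0_le0.
have l'1 : \sum_i l' i = 1 by rewrite sumrB -mulr_sumr sc mulr0 subr0.
have l'i1 : l' i1 = 0 by rewrite /l' /t divfK ?subrr// gt_eqF.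
have l'v : \sum_i l' i *: v i = \sum_i l i *: v i.
  under eq_bigr do rewrite scalerBl -scalerA.
  by rewrite sumrB -scaler_sumr scv scaler0 subr0.
have s1 : \sum_j l' (lift i1 j) = 1 by rewrite -l'1 (bigD1_ord i1)//= l'i1 add0r.
have [w [k [w1 w2 w3 w4]]] := ih (fun j => v (lift i1 j)) _ (fun j => l'0 _) s1.
exists w, k; split => //.
  by move=> j; have [i ->] := w1 j; exists (lift i1 i).
by rewrite -w4 -l'v (bigD1_ord i1)//= l'i1 scale0r add0r.
Qed.

Lemma convex_sum S N (v : 'I_N -> 'rV[R]_n) (l : 'I_N -> R) :
  @convex_set R 'rV[R]_n S ->
  (forall i, S (v i)) -> (forall i, 0 <= l i) -> \sum_i l i = 1 ->
  S (\sum_i l i *: v i).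
Proof.
move=> /convex_setP vS; elim: N v l => [|N ih] v l Sv l0 l1.
  by move: l1; rewrite big_ord0 => /eqP; rewrite eq_sym oner_eq0.
have [e|e] := eqVneq (l ord0) 1.
  rewrite big_ord_recl e scale1r big1 ?addr0// => i _.
  have /eqP : \sum_i l (lift ord0 i) = 0.
    by move: l1; rewrite big_ord_recl e => /eqP; rewrite -subr_eq0 addrAC subrr add0r => /eqP.
  rewrite psumr_eq0 // => /allP /(_ i (mem_index_enum i)) /= /eqP ->.
  by rewrite scale0r.
pose s := 1 - l ord0.
have hs : \sum_i l (lift ord0 i) = s by rewrite /s -l1 big_ord_recl addrAC subrr add0r.
have s0 : s != 0 by rewrite subr_eq0 eq_sym.
have s0' : 0 <= s by rewrite -hs; apply: sumr_ge0.
have -> : \sum_i l i *: v i =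
    l ord0 *: v ord0 + (1 - l ord0) *: \sum_i (l (lift ord0 i) / s) *: v (lift ord0 i).
  rewrite big_ord_recl scaler_sumr; congr (_ + _); apply: eq_bigr => i _.
  by rewrite scalerA -/s mulrC divfK.
apply: vS => //; last by rewrite l0 -subr_ge0.
apply: ih => [i|i|]; [exact: Sv|by rewrite divr_ge0|].
by rewrite -mulr_suml hs divff.
Qed.

(** A fixed number of points is what later exhibits the hull as the image of one compact set. These
    combinations form a convex set because a mixture of two of them, which involves 2 (n + 1)
    points, is cut down again by [caratheodory]. *)
Lemma convex_hullE S x : convex_hull S x ->
  exists (w : 'rV['rV[R]_n]_n.+1) (k : 'rV[R]_n.+1),
    [/\ forall j, S (w 0 j), forall j, 0 <= k 0 j, \sum_j k 0 j = 1
      & x = \sum_j k 0 j *: w 0 j].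
Proof.
pose T : set 'rV[R]_n := [set x | exists (w : 'rV['rV[R]_n]_n.+1) (k : 'rV[R]_n.+1),
    [/\ forall j, S (w 0 j), forall j, 0 <= k 0 j, \sum_j k 0 j = 1
      & x = \sum_j k 0 j *: w 0 j]].
move=> h; apply: (h T); split; last first.
  move=> s Ss; exists (\row__ s), (delta_mx 0 ord0); split => [j|j||].
  - by rewrite mxE.
  - by rewrite mxE ler0n.
  - by rewrite (bigD1 ord0)//= mxE !eqxx big1 ?addr0// => i /negPf hi; rewrite mxE hi andbF.
  - rewrite (bigD1 ord0)//= !mxE !eqxx scale1r big1 ?addr0// => i /negPf hi.
    by rewrite !mxE hi andbF scale0r.
apply/convex_setP => a b t [w [k [w1 k1 k2 ->]]] [w' [k' [w1' k1' k2' ->]]] /andP[t0 t1].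
pose v (i : 'I_(n.+1 + n.+1)) := match fintype.split i with inl j => w 0 j | inr j => w' 0 j end.
pose l (i : 'I_(n.+1 + n.+1)) := match fintype.split i with inl j => t * k 0 j | inr j => (1 - t) * k' 0 j end.
have [|| w2 [k3 [h1 h2 h3 h4]]] := @caratheodory _ v l.
- by move=> i; rewrite /l; case: fintype.split => j; rewrite mulr_ge0// subr_ge0.
- rewrite big_split_ord /=.
  under eq_bigr do rewrite /l (unsplitK (inl _)).
  under [X in _ + X]eq_bigr do rewrite /l (unsplitK (inr _)).
  by rewrite -!mulr_sumr k2 k2' !mulr1 addrC subrK.
exists w2, k3; split => //.
  by move=> j; have [i ->] := h1 j; rewrite /v; case: fintype.split.
rewrite -h4 big_split_ord /=.
under [in RHS]eq_bigr do rewrite /l /v (unsplitK (inl _)).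
under [X in _ = _ + X]eq_bigr do rewrite /l /v (unsplitK (inr _)).
by rewrite !scaler_sumr; congr (_ + _); apply: eq_bigr => i _; rewrite scalerA.
Qed.

(** The hull is the continuous image of the product of the (n + 1)-tuples in S with the simplex D of
    weights, itself closed in a compact cube. *)
Lemma convex_hull_compact S : compact S -> compact (convex_hull S).
Proof.
move=> cS.
pose f (z : 'rV['rV[R]_n]_n.+1 * 'rV[R]_n.+1) : 'rV[R]_n := \sum_j z.2 0 j *: z.1 0 j.
have cf : continuous f.
  apply: rV_continuous => i.
  rewrite (_ : (fun z => _) =
    (fun z : 'rV['rV[R]_n]_n.+1 * 'rV[R]_n.+1 => \sum_j z.2 0 j * z.1 0 j 0 i)); last first.
    by apply/funext => z; rewrite summxE; apply: eq_bigr => j _; rewrite mxE.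
  apply: (@sum_continuous _ _ _ _ _ (fun j (z : 'rV['rV[R]_n]_n.+1 * 'rV[R]_n.+1) => z.2 0 j * z.1 0 j 0 i)) => j _.
  apply: contM.
    apply: (cont_comp _ (@coord_continuous_rV R n.+1 j)).
    by move=> z; exact: cvg_snd.
  apply: (cont_comp (f := fun z : 'rV['rV[R]_n]_n.+1 * 'rV[R]_n.+1 => z.1 0 j) _ (@coord_continuous_rV R n i)).
  move=> z U [P nP sP].
  exists ([set w : 'rV['rV[R]_n]_n.+1 | U (w 0 j)], setT).
    split; last exact: filterT.
    exists (fun i k => if k == j then U else setT) => /=.
      move=> i' k; case: eqP => [->|_]; last exact: filterT.
      by rewrite (ord1 i'); exists P.
    by move=> w /= /(_ 0 j); rewrite eqxx.
  by move=> [w k] [].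
pose D : set 'rV[R]_n.+1 := [set k | forall j, `[0, 1]%classic (k 0 j)] `&` [set k | \sum_j k 0 j = 1].
have cD : compact D.
  apply: (@subclosed_compact _ _ [set k : 'rV[R]_n.+1 | forall j, `[0, 1]%classic (k 0 j)]).
  - apply: closedI.
      rewrite [X in closed X](_ : _ = \bigcap_(j in [set: 'I_n.+1])
          ((fun k : 'rV[R]_n.+1 => k 0 j) @^-1` `[0, 1]%classic)); last first.
        by apply/seteqP; split => k /= hk j; [move=> _; exact: hk|exact: (hk j I)].
      apply: closed_bigI => j _; apply: preimage_closed; last exact: interval_closed.
      by move=> k _; exact: coord_continuous_rV.
    apply: (@preimage_closed _ _ (fun k : 'rV[R]_n.+1 => \sum_j k 0 j) [set 1]).
      move=> k _; apply: (@sum_continuous _ _ _ _ _ (fun j (k : 'rV[R]_n.+1) => k 0 j)) => j _.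
      exact: coord_continuous_rV.
    exact: closed_eq.
  - exact: (@rV_compact R _ (fun=> `[0, 1]%classic) (fun=> @segment_compact _ _ _)).
  - exact: subIsetl.
have -> : convex_hull S = f @` ([set w : 'rV['rV[R]_n]_n.+1 | forall j, S (w 0 j)] `*` D).
  apply/seteqP; split => x.
    move=> /convex_hullE [w [k [h1 h2 h3 ->]]]; exists (w, k) => //; split => //=.
    split => //= j; rewrite in_itv /= h2 /= -h3 (bigD1 j)//= lerDl.
    exact: sumr_ge0.
  move=> [[w k] [/= Sw [/= k01 k1]] <-]; apply: convex_sum => //.
  - exact: convex_hull_convex.
  - by move=> j; apply: sub_convex_hull.
  - by move=> j; have := k01 j; rewrite in_itv /= => /andP[].
apply: continuous_compact; first exact: continuous_subspaceT.
apply: compact_setX => //.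
exact: (@rV_compact _ _ (fun=> S) (fun=> cS)).
Qed.

(* The supporting functional is a limit of the ones separating E from points
   approaching m from the side opposite to E. *)
Lemma supporting_functional E m : open E -> @convex_set R 'rV[R]_n E -> ~ E m ->
  exists u : 'rV[R]_n, forall e, E e -> dot u (e - m) < 0.
Proof.
move=> oE vE Em.
have [[e0 Ee0]|E0] := pselect (E !=set0); last first.
  by exists 0 => e Ee; case: E0; exists e.
(* These points lie beyond m as seen from [e0] and tend to m. If one were in the closure of E, then
   m, strictly between it and [e0], would be in E. *)
pose mk (k : nat) := m + (k.+1%:R^-1) *: (m - e0).
have mkE k : ~ closure E (mk k).
  move=> cm; apply: Em.
  have k0 : (0 : R) < k.+1%:R by rewrite ltr0n.
  have k2 : (0 : R) < k.+2%:R by rewrite ltr0n.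
  have -> : m = k.+2%:R^-1 *: e0 + (1 - k.+2%:R^-1) *: mk k.
    apply/rowP => i; rewrite !mxE; field.
    by rewrite -!natr1 in k0 k2 *; rewrite !gt_eqF.
  apply: open_convex_segment => //; rewrite invr_gt0 k2 /= invf_le1//.
  by rewrite ler1n.
have uk k : exists u : 'rV[R]_n, dot u u = 1 /\ forall e, E e -> dot u (e - mk k) <= 0.
  have [||y cy hy] := @nearest_point (closure E) (mk k) (@closed_closure _ _) (closure_convex vE).
  - by exists e0; apply: subset_closure.
  - exact: mkE.
  have u0 : mk k - y != 0.
    by rewrite subr_eq0; apply/eqP => h; apply: (mkE k); rewrite h.
  have d0 := dot_gt0 u0.
  exists ((Num.sqrt (dot (mk k - y) (mk k - y)))^-1 *: (mk k - y)); split.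
    rewrite dotZl dotZr mulrA -expr2 exprVn sqr_sqrtr ?ltW// mulVf// gt_eqF//.
  move=> e Ee; rewrite dotZl mulr_ge0_le0 ?invr_ge0 ?sqrtr_ge0//.
  rewrite (_ : e - mk k = (e - y) - (mk k - y)); last by rewrite opprB addrA subrK.
  rewrite dotDr dotNr subr_le0; apply: le_trans (hy _ (subset_closure Ee)) _.
  exact: ltW.
pose u k := projT1 (cid (uk k)).
have u1 k : dot (u k) (u k) = 1 by rewrite /u; case: cid => /= ? [].
have uE k e : E e -> dot (u k) (e - mk k) <= 0 by rewrite /u; case: cid => /= ? []; auto.
pose S : set 'rV[R]_n := setT `&` [set x | dot (x - 0) (x - 0) <= 1].
have cS : compact S by exact/closed_sqdist_le_compact/closedT.
have uS k : S (u k) by split => //; rewrite /mkset subr0 u1.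
have [|v [_ cv]] := cS (u k @[k --> \oo]) _.
  by exists 0%N => // k _; exact: uS.
have le0 e : E e -> dot v (e - m) <= 0.
  move=> Ee; rewrite leNgt; apply/negP => h.
  set a := dot v (e - m) in h.
  (* B bounds [dot (u k) (m - e0)] for all k, so [dot (u k) (e - m)] is at most B / (k + 1), which
     falls below a / 2, although v is a cluster point of the [u k]. *)
  pose B : R := \sum_i `|(m - e0) 0 i|.
  have uB k : `|dot (u k) (m - e0)| <= B.
    rewrite /B /dot; apply: le_trans (ler_norm_sum _ _ _) _.
    apply: ler_sum => i _; rewrite normrM ler_piMl//.
    rewrite -(@ler_pXn2r _ 2) ?nnegrE// expr1n real_normK ?num_real// -(u1 k).
    rewrite /dot (bigD1 i)//= -expr2 lerDl.
    by apply: sumr_ge0 => j _; rewrite -expr2 sqr_ge0.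
  have n1 : nbhs v [set x | a / 2 < dot x (e - m)].
    have -> : [set x | a / 2 < dot x (e - m)] = dot (e - m) @^-1` [set y | a / 2 < y].
      by apply/seteqP; split => x /=; rewrite dotC.
    apply: dot_continuous; apply: open_nbhs_nbhs; split; first exact: open_gt.
    by rewrite /= dotC -/a; lra.
  have n2 : (u k @[k --> \oo]) [set x | dot x (e - m) < a / 2].
    have hB : 0 < a / 2 by lra.
    exists (Num.trunc (B / (a / 2))) => // k /= hk.
    have := uE k _ Ee; rewrite /mk opprD addrA (dotDr (e - m)) dotNr dotZr subr_le0 => h1.
    apply: le_lt_trans h1 _; rewrite mulrC ltr_pdivrMr ?ltr0n//.
    apply: le_lt_trans (ler_norm _) _; apply: le_lt_trans (uB k) _.
    rewrite mulrC -ltr_pdivrMr//; apply: lt_le_trans (truncnS_gt _) _.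
    by rewrite ler_nat ltnS.
  have [x [/= h1 h2]] := cv _ _ n2 n1.
  by move: (lt_trans h1 h2); rewrite ltxx.
have v0 : v != 0.
  have cl : closed [set x : 'rV[R]_n | dot (x - 0) (x - 0) = 1].
    apply: (@preimage_closed _ _ (fun x : 'rV[R]_n => dot (x - 0) (x - 0)) [set 1]).
      by move=> x _; exact: sqdist_continuous.
    exact: closed_eq.
  have : [set x : 'rV[R]_n | dot (x - 0) (x - 0) = 1] v.
    rewrite closedE in cl; apply: cl => h.
    have n2 : (u k @[k --> \oo]) [set x | dot (x - 0) (x - 0) = 1].
      by exists 0%N => // k _; rewrite /mkset/= subr0 u1.
    by have [x [/= h1 h2]] := cv _ _ n2 h.
  rewrite /= subr0; apply: contra_eq_neq => ->.
  by rewrite dotr0 eq_sym oner_eq0.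
exists v => e Ee.
rewrite lt_neqAle le0// andbT; apply/eqP => e1.
(* Strictness comes from openness: if the functional vanished at e, a small step along v would stay
   in E and make it positive. *)
pose g (t : R) : 'rV[R]_n := e + t *: v.
have cg : continuous g.
  apply: rV_continuous => i.
  rewrite (_ : (fun t => _) = (fun t : R => e 0 i + t * v 0 i)); last first.
    by apply/funext => t; rewrite !mxE.
  apply: contD; first exact: contc.
  apply: contM; last exact: contc.
  by move=> t; exact: cvg_id.
have : nbhs (0 : R) (g @^-1` E).
  by apply: cg; rewrite /g scale0r addr0; exact: open_nbhs_nbhs.
move=> /nbhs_ballP [r /= r0 hr].
have /hr /le0 : ball (0 : R) r (r / 2).
  by rewrite -ball_normE /= sub0r normrN gtr0_norm ?divr_gt0//; lra.
rewrite /g addrAC dotDr e1 add0r dotZr leNgt => /negP; apply.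
by rewrite mulr_gt0 ?divr_gt0// dot_gt0.
Qed.

(* If x in K lay outside the hull of V, some ball would contain V but not x,
   and a point of K farthest from its centre could not lie on a segment of K. *)
Lemma sub_hull_of_segments K V : compact K -> compact V ->
  (forall m, K m -> ~ V m -> exists d : 'rV[R]_n, [/\ d != 0, K (m + d) & K (m - d)]) ->
  K `<=` convex_hull V.
Proof.
move=> cK cV hseg x Kx; apply: contrapT => Qx.
have [c hc] : exists c, forall s, V s -> dot (s - c) (s - c) < dot (x - c) (x - c).
  have [V0|V0] := pselect (V !=set0); last first.
    by exists 0 => s Vs; case: V0; exists s.
  have cQ := convex_hull_compact cV.
  have [||y Qy hy] := @nearest_point (convex_hull V) x _ (@convex_hull_convex V) _ Qx.
  - by apply: compact_closed => //; exact: norm_hausdorff.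
  - by case: V0 => s Vs; exists s; apply: sub_convex_hull.
  have [|s0 Vs0 hs0] := @compact_EVT_max _ R (fun z : 'rV[R]_n => dot (z - y) (z - y)) V V0 cV.
    exact/continuous_subspaceT/sqdist_continuous.
  set B := dot (s0 - y) (s0 - y) in hs0.
  have xy0 : x - y != 0.
    by rewrite subr_eq0; apply/eqP => h; apply: Qx; rewrite h.
  have d0 := dot_gt0 xy0; set d := dot (x - y) (x - y) in d0.
  have B0 : 0 <= B by exact: dot_ge0.
  pose T := B / d.
  have T0 : 0 <= T by rewrite divr_ge0// ltW.
  have TB : T * d = B by rewrite /T divfK// gt_eqF.
  (* The centre is pushed back from y, away from x. From there the points of V are at squared
     distance at most B + T ^ 2 d, while x is at (1 + T) ^ 2 d = d + 2 B + T ^ 2 d. *)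
  exists (y - T *: (x - y)) => s Vs.
  have -> : s - (y - T *: (x - y)) = (s - y) + T *: (x - y) by apply/rowP => i; rewrite !mxE; ring.
  have -> : x - (y - T *: (x - y)) = (x - y) + T *: (x - y) by apply/rowP => i; rewrite !mxE; ring.
  rewrite (dot_sqD (s - y)) (dot_sqD (x - y)) !(dotZl, dotZr) -/d (dotC (s - y) (x - y)).
  have h1 := hy s (sub_convex_hull Vs).
  have h2 : dot (s - y) (s - y) <= B by apply: hs0; rewrite inE.
  have h3 : T * dot (x - y) (s - y) <= 0 by apply: mulr_ge0_le0.
  by nra.
have [||m Km hm] := @compact_EVT_max _ R (fun z : 'rV[R]_n => dot (z - c) (z - c)) K _ cK.
- by exists x.
- exact/continuous_subspaceT/sqdist_continuous.
have {}hm z : K z -> dot (z - c) (z - c) <= dot (m - c) (m - c).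
  by move=> Kz; apply: hm; rewrite inE.
have Vm : ~ V m by move=> /hc; rewrite ltNge hm.
rewrite inE in Km.
have [d [d0 Kd Kd']] := hseg m Km Vm.
(* By the parallelogram law, the mean of the squared distances of m + d and m - d to c exceeds that
   of m by [dot d d]. *)
have := hm _ Kd; have := hm _ Kd'; have := dot_gt0 d0.
have -> : m - d - c = (m - c) - d by rewrite addrAC.
have -> : m + d - c = (m - c) + d by rewrite addrAC.
rewrite (dot_sqB (m - c)) (dot_sqD (m - c) d); lra.
Qed.

End ConvexSets.

(** * Averages over roots of unity *)

Section LogDerivative.
Context {C : fieldType}.

Lemma log_deriv_prod (s : seq C) (u : C) : u \notin s ->
  let P := \prod_(z <- s) ('X - z%:P) in
  P^`().[u] / P.[u] = \sum_(z <- s) (u - z)^-1.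
Proof.
elim: s => [|z s ih] /=.
  by rewrite !big_nil derivC horner0 mul0r.
rewrite inE negb_or => /andP[uz us]; rewrite !big_cons -ih//.
set P := \prod_(_ <- _) _.
have P0 : P.[u] != 0 by rewrite -[_ == 0]/(root P u) root_prod_XsubC.
rewrite derivM derivXsubC mul1r hornerD !hornerM hornerXsubC.
by field; rewrite P0 subr_eq0 uz.
Qed.

(** Each term is 1 - x / (x - zeta^k), and the sum of the 1 / (x - zeta^k) is the logarithmic
    derivative of X^N - 1 at x. *)
Lemma sum_primitive_root (N : nat) (zeta x : C) :
  N.-primitive_root zeta -> x ^+ N != 1 ->
  \sum_(k < N) zeta ^+ k / (zeta ^+ k - x) = N%:R / (1 - x ^+ N).
Proof.
move=> hz xN.
have N0 := prim_order_gt0 hz.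
have hx (k : 'I_N) : zeta ^+ k - x != 0.
  rewrite subr_eq0; apply: contra xN => /eqP <-.
  by rewrite exprAC (prim_expr_order hz) expr1n.
pose s := [seq zeta ^+ i | i <- index_iota 0 N].
have xs : x \notin s.
  apply/mapP => -[l]; rewrite mem_index_iota => /andP[_ iN] xi.
  by have := hx (Ordinal iN); rewrite /= xi subrr eqxx.
have := log_deriv_prod xs; rewrite /= !big_map (factor_Xn_sub_1 hz).
rewrite derivB derivXn derivC subr0 hornerMn !hornerE => h.
have -> : \sum_(k < N) zeta ^+ k / (zeta ^+ k - x) =
    \sum_(k < N) (1 - x * (x - zeta ^+ k)^-1).
  by apply: eq_bigr => k _; rewrite -[x - _]opprB; field; rewrite oppr_eq0 !hx.
rewrite sumrB sumr_const card_ord -mulr_sumr -(big_mkord xpredT (fun k => (x - zeta ^+ k)^-1)) -h.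
rewrite -[in x ^+ N](prednK N0) exprS in xN *.
rewrite -mulr_natl; field.
by rewrite !subr_eq0 xN eq_sym xN.
Qed.

End LogDerivative.

Section RootCount.
Context {C : numClosedFieldType}.

(** For y the N-th power of the ratio of a root to the radius, 1 / (1 - y) approximates the
    indicator of the disc. The bound on e keeps [|1 - y|] at least 1/2 in the first case and at
    least [|y|] / 2 in the second. *)
Lemma indicator_error (y : C) (e : C) : 0 < e -> 2 * e <= 1 ->
  (`|y| <= e -> `|1 / (1 - y) - 1| <= 2 * e) /\
  (1 <= e * `|y| -> `|1 / (1 - y)| <= 2 * e).
Proof.
move=> e0 e1; split=> hy.
  have h1 : 1 - e <= `|1 - y|.
    apply: le_trans (lerB_dist _ _); rewrite normr1 lerD2l lerN2//.
  have h2 : 2^-1 <= 1 - e.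
    rewrite lerBrDr [X in _ <= X](_ : 1 = 2^-1 + 2^-1); last by field.
    by rewrite lerD2l -[2^-1]mulr1 ler_pdivlMl.
  have h3 : 0 < `|1 - y| by apply: lt_le_trans (le_trans h2 h1); rewrite invr_gt0.
  have n0 : 1 - y != 0 by rewrite -normr_gt0.
  rewrite (_ : 1 / (1 - y) - 1 = y / (1 - y)); last by field.
  rewrite normrM normfV ler_pdivrMr//.
  apply: le_trans hy _; apply: le_trans (ler_wpM2l _ (le_trans h2 h1)).
    by rewrite [leRHS](_ : _ = e)//; field.
  by rewrite mulr_ge0 ?ltW.
have y1 : 2 <= `|y|.
  rewrite -(ler_pM2l e0); apply: le_trans hy; by rewrite mulrC.
have h1 : `|y| / 2 <= `|1 - y|.
  rewrite distrC; apply: le_trans (lerB_dist _ _); rewrite normr1.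
  rewrite lerBrDr -lerBrDl (_ : `|y| - `|y| / 2 = `|y| / 2); last by field.
  by rewrite ler_pdivlMr// mul1r.
have h3 : 0 < `|1 - y|.
  by apply: lt_le_trans h1; rewrite divr_gt0//; apply: lt_le_trans y1.
rewrite normrM normr1 mul1r normfV -[X in X <= _]mul1r ler_pdivrMr//.
apply: le_trans hy _; apply: le_trans (ler_wpM2l _ h1).
  by rewrite [leRHS](_ : _ = e * `|y|)//; field.
by rewrite mulr_ge0 ?ltW.
Qed.

(** The logarithmic derivative splits the average into one term 1 / (1 - (z / r)^N) per root z. An
    annulus of ratio q on either side of [|r|] without roots puts each term within 2 q^-N of 0 or
    1. *)
Lemma root_count_approx (s : seq C) (c r : C) (q : C) (N : nat) (zeta : C) :
  let P := c *: \prod_(z <- s) ('X - z%:P) in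
  N.-primitive_root zeta -> c != 0 -> r != 0 -> 1 < q -> 2 <= q ^+ N ->
  (forall z, z \in s -> `|z| * q <= `|r| \/ `|r| * q <= `|z|) ->
  `|N%:R^-1 * (\sum_(k < N) r * zeta ^+ k * P^`().[r * zeta ^+ k] / P.[r * zeta ^+ k])
    - (count (fun z => `|z| < `|r|) s)%:R| <= (size s)%:R * (2 * q ^- N).
Proof.
move=> P hz c0 r0 q1 qN hs.
have N0 := prim_order_gt0 hz.
have q0 : 0 < q by apply: lt_trans q1.
have rp : 0 < `|r| by rewrite normr_gt0.
have zN : zeta != 0 
  by apply: contra_eq_neq (prim_expr_order hz) => ->; rewrite expr0n gtn_eqF// eq_sym oner_eq0.
have zn1 k : `|zeta ^+ k| = 1.
  apply/eqP; rewrite -(@eqrXn2 _ N)// ?normr_ge0// -normrX exprAC.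
  by rewrite (prim_expr_order hz) !expr1n normr1.
have hx z : z \in s -> (z / r) ^+ N != 1.
  move=> zs; apply/negP => /eqP h.
  have : `|z / r| = 1.
    by apply/eqP; rewrite -(@eqrXn2 _ N)// ?normr_ge0// -normrX h normr1 expr1n.
  rewrite normrM normfV => /(canRL (mulfVK _)); rewrite mul1r => e.
  have {}e : `|z| = `|r| by apply: e; rewrite gt_eqF.
  by case: (hs z zs); rewrite e ger_pMr// => /(lt_le_trans q1); rewrite ltxx.
have ns (k : 'I_N) : r * zeta ^+ k \notin s.
  apply/negP => /hx; rewrite mulrAC mulfV// mul1r exprAC (prim_expr_order hz) expr1n.
  by rewrite eqxx.
have -> : \sum_(k < N) r * zeta ^+ k * P^`().[r * zeta ^+ k] / P.[r * zeta ^+ k] =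
    \sum_(z <- s) N%:R * (1 / (1 - (z / r) ^+ N)).
  transitivity (\sum_(k < N) \sum_(z <- s) zeta ^+ k / (zeta ^+ k - z / r)).
    apply: eq_bigr => k _; rewrite /P derivZ !hornerZ -mulrA -mulf_div mulfV// mul1r.
    rewrite log_deriv_prod// mulr_sumr; apply: eq_big_seq => z zs.
    have h : r * zeta ^+ k - z != 0.
      by rewrite subr_eq0; apply: contraNneq (ns k) => ->.
    by field; rewrite r0 mulrC h.
  rewrite exchange_big /=; apply: eq_big_seq => z zs.
  by rewrite (sum_primitive_root hz (hx z zs)) mul1r.
rewrite -mulr_sumr mulKf ?pnatr_eq0 -?lt0n//.
have -> : (count (fun z : C => `|z| < `|r|) s)%:R = \sum_(z <- s) (`|z| < `|r|)%R%:R :> C.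
  by rewrite -sum1_count natr_sum big_mkcond /=; apply: eq_bigr => z _; case: ifP.
rewrite -sumrB; apply: le_trans (ler_norm_sum _ _ _) _.
rewrite -[X in X%:R]sum1_size natr_sum mulr_suml big_seq [leRHS]big_seq.
apply: ler_sum => z zs; rewrite [leRHS]mul1r.
have qN0 : 0 < q ^+ N by rewrite exprn_gt0.
have e0 : 0 < q ^- N by rewrite invr_gt0.
have e1 : 2 * q ^- N <= 1 by rewrite ler_pdivrMr// mul1r.
have [h1 h2] := indicator_error ((z / r) ^+ N) e0 e1.
case: (hs z zs) => hzr.
  have -> : `|z| < `|r|.
    have [->|z0] := eqVneq z 0; first by rewrite normr0.
    by apply: lt_le_trans hzr; rewrite ltr_pMr ?normr_gt0.
  apply: h1; rewrite -exprVn normrX lerXn2r ?nnegrE ?invr_ge0 ?(ltW q0)//.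
  by rewrite normrM normfV ler_pdivrMr// ler_pdivlMl// mulrC.
have -> : `|z| < `|r| = false.
  apply/negP => h; have := lt_le_trans h (le_trans _ hzr); rewrite ltxx.
  by move=> /(_ (ler_peMr (ltW rp) (ltW q1))).
rewrite subr0; apply: h2.
rewrite mulrC ler_pdivlMr// mul1r normrX lerXn2r ?nnegrE ?(ltW q0)//.
by rewrite normrM normfV ler_pdivlMr// mulrC.
Qed.

End RootCount.

(** * Means over a torus *)

Lemma pair_continuous (T U : topologicalType) (x : T) :
  continuous (fun t : U => (x, t)).
Proof.
move=> t W [[A B] [/= nA nB] AB].
by apply: filterS nB => b Bb; apply: (AB (x, b)); split => //; exact: nbhs_singleton.
Qed.

Section CircleMean.
Context {R : realType}.
Implicit Types (f g h : R -> R).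

Lemma twopi_gt0 : 0 < 2 * pi :> R.
Proof. by rewrite mulr_gt0// pi_gt0. Qed.

Lemma continuous_integrable h (a b : R) : continuous h ->
  (@lebesgue_measure R).-integrable `[a, b] (EFin \o h).
Proof.
move=> ch; apply: continuous_compact_integrable; first exact: segment_compact.
exact: continuous_subspaceT.
Qed.

(** One antiderivative on a prescribed interval lets the integrals over shifted periods be compared
    as differences of its values. *)
Lemma antiderivative h (M : R) : 0 < M -> continuous h ->
  exists F : R -> R, forall x, - M < x < M -> is_derive x 1 F (h x).
Proof.
move=> M0 ch; exists (fun x => \int[lebesgue_measure]_(t in `[- M, x]) h t) => x /andP[x1 x2].
have [d e] := @continuous_FTC1_closed R h (- M) x M x2
  (continuous_integrable (- M) M ch) x1 (ch x).
apply: DeriveDef; first exact: d.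
by rewrite -derive1E; exact: e.
Qed.

Lemma integral_antiderivative h F (a b : R) : a < b -> continuous h ->
  (forall x, a <= x <= b -> is_derive x 1 F (h x)) ->
  \int[lebesgue_measure]_(t in `[a, b]) h t = F b - F a.
Proof.
move=> ab ch dF; rewrite /Rintegral (@continuous_FTC2 _ h F)//.
- exact: continuous_subspaceT.
- have cF x : a <= x <= b -> {for x, continuous F}.
    move=> /dF /@ex_derive /derivable1_diffP; exact: differentiable_continuous.
  split.
  + by move=> x /[!in_itv]/= /andP[/ltW x1 /ltW x2]; have [] : is_derive x 1 F (h x) by apply: dF; rewrite x1.
  + by apply: cvg_at_right_filter; apply: cF; rewrite lexx ltW.
  + by apply: cvg_at_left_filter; apply: cF; rewrite lexx ltW.
- move=> x /[!in_itv]/= /andP[/ltW x1 /ltW x2].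
  have [_ <-] : is_derive x 1 F (h x) by apply: dF; rewrite x1.
  by rewrite derive1E.
Qed.

Definition cmean h : R := (2 * pi)^-1 * \int[lebesgue_measure]_(t in `[0, 2 * pi]) h t.

Lemma cmeanD f g : continuous f -> continuous g ->
  cmean (fun t => f t + g t) = cmean f + cmean g.
Proof.
move=> cf cg; rewrite /cmean RintegralD ?mulrDr//; exact: continuous_integrable.
Qed.

Lemma cmeanZ a f : continuous f -> cmean (fun t => a * f t) = a * cmean f.
Proof.
move=> cf; rewrite /cmean RintegralZl//; first by rewrite mulrCA.
exact: continuous_integrable.
Qed.

Lemma cmean_cst (a : R) : cmean (fun=> a) = a.
Proof.
rewrite /cmean Rintegral_cst; last exact: measurable_itv.
rewrite [X in fine X](_ : _ = (2 * pi)%:E); last first.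
  etransitivity; first exact: (lebesgue_measure_itv `[0, 2 * pi]).
  by rewrite /= lte_fin twopi_gt0 -EFinD subr0.
rewrite /=.
by rewrite mulrC mulfK// gt_eqF// twopi_gt0.
Qed.

Lemma le_cmean f g : continuous f -> continuous g ->
  (forall t, 0 <= t <= 2 * pi -> f t <= g t) -> cmean f <= cmean g.
Proof.
move=> cf cg fg; rewrite /cmean ler_pM2l ?invr_gt0 ?twopi_gt0//.
by apply: le_Rintegral => //; exact: continuous_integrable.
Qed.

Lemma cmean_bound f g (e : R) : continuous f -> continuous g ->
  (forall t, 0 <= t <= 2 * pi -> `|f t - g t| <= e) -> `|cmean f - cmean g| <= e.
Proof.
move=> cf cg h.
have -> : cmean f - cmean g = cmean (fun t => f t - g t).
  rewrite cmeanD//; last exact: contN.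
  congr (_ + _); rewrite -mulN1r -cmeanZ//; congr cmean.
  by apply/funext => t; rewrite mulN1r.
have c : continuous (fun t => f t - g t) by exact: contB.
rewrite ler_norml -[X in X <= _ <= _]cmean_cst -[X in _ <= _ <= X]cmean_cst.
by apply/andP; split; apply: le_cmean; (try exact: contc) => // t /h;
  rewrite ler_norml => /andP[].
Qed.

(** The integral over the period starting at x is F (x + 2 pi) - F x, whose derivative in x vanishes
    by periodicity. *)
Lemma cmean_shift h (a : R) : continuous h -> (forall t, h (t + 2 * pi) = h t) ->
  cmean (fun t => h (t + a)) = cmean h.
Proof.
move=> ch per; rewrite /cmean; congr (_ * _).
have tp := twopi_gt0.
(* All arguments of F below lie in [-|a|, |a| + 2 pi], hence strictly between - M and M. *)
pose M : R := `|a| + 2 * pi + 1.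
have M0 : 0 < M by rewrite /M; have := normr_ge0 a; lra.
have [F dF] := antiderivative M0 ch.
have a1 : a <= `|a| := ler_norm a.
have a2 : - a <= `|a| by rewrite -normrN; exact: ler_norm.
have dFs b x : - M < x + b < M -> is_derive x 1 (fun t => F (t + b)) (h (x + b)).
  move=> /dF d; have := @is_derive1_comp R F (fun t => t + b) x (h (x + b)) 1 d _.
  rewrite mulr1; apply.
  by rewrite -[X in is_derive _ _ _ X]addr0; apply: is_deriveD.
have cha : continuous (fun t => h (t + a)).
  by apply: (cont_comp _ ch); apply: contD; [move=> t; exact: cvg_id|exact: contc].
have d1 x : 0 <= x <= 2 * pi -> is_derive x 1 (fun t => F (t + a)) (h (x + a)).
  by move=> /andP[x0 x1]; apply: dFs; rewrite /M; apply/andP; split; lra.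
have d2 x : 0 <= x <= 2 * pi -> is_derive x 1 F (h x).
  by move=> /andP[x0 x1]; apply: dF; rewrite /M; apply/andP; split; lra.
rewrite (integral_antiderivative tp cha d1) (integral_antiderivative tp ch d2).
pose G x := F (x + 2 * pi) - F x.
suff : G a = G 0 by rewrite /G (addrC a) !add0r.
have dG x : - `|a| <= x <= `|a| -> is_derive x 1 G 0.
  move=> /andP[x1 x2]; rewrite -(subrr (h x)) -{1}per.
  apply: is_deriveB; first by apply: dFs; rewrite /M; apply/andP; split; lra.
  by apply: dF; rewrite /M; apply/andP; split; lra.
have aa : - `|a| <= `|a| by rewrite ge0_cp.
have eG x : - `|a| <= x <= `|a| -> G x = G (- `|a|).
  move=> /andP[x1 x2].
  have [||c _] := @MVT_segment R G (fun=> 0) (- `|a|) x x1.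
  - move=> y /[!in_itv]/= /andP[y1 y2]; apply: dG; rewrite (ltW y1) /=.
    by apply: le_trans x2; exact: ltW.
  - apply: derivable_within_continuous => y /[!in_itv]/= /andP[y1 y2].
    have [] // : is_derive y 1 G 0 by apply: dG; rewrite y1 /=; exact: le_trans x2.
  by rewrite mul0r => /eqP; rewrite subr_eq0 => /eqP.
rewrite !eG//.
  by rewrite oppr_le0 normr_ge0.
by rewrite lerNl a2 a1.
Qed.

(** Compactness of [0, 2 pi] makes the continuity in the parameter uniform in t. *)
Lemma cmean_param (T : topologicalType) (G : T -> R -> R) :
  continuous (fun z : T * R => G z.1 z.2) -> continuous (fun x => cmean (G x)).
Proof.
move=> cG x.
have cGx y : continuous (G y).
  exact: (cont_comp (@pair_continuous _ _ y) cG).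
apply/cvgrPdist_le => e e0.
have := @segment_compact R 0 (2 * pi).
move=> /compact_near_coveringP /(_ T (nbhs x) (fun y t => `|G x t - G y t| <= e)) hc.
have {}hc : \forall y \near x, `[0, 2 * pi] `<=` (fun t => `|G x t - G y t| <= e).
  apply: hc => t _.
  have e20 : 0 < e / 2 by rewrite divr_gt0.
  have h1 : \forall z \near (x, t), `|G x t - G z.1 z.2| <= e / 2.
    by move/cvgrPdist_le : (cG (x, t)); apply.
  have h2 : \forall t' \near t, `|G x t - G x t'| <= e / 2.
    by move/cvgrPdist_le : (cGx x t); apply.
  case: h1 => -[U V] /= [nU nV] UV.
  exists (V `&` [set t' | `|G x t - G x t'| <= e / 2], U) => /=.
    by split => //; apply: filterI.
  move=> [t' y] [/= [Vt' ht'] Uy].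
  have /= hy := UV (y, t') (conj Uy Vt').
  rewrite -(subrKA (G x t)) [e]splitr (le_trans (ler_normD _ _))// lerD// distrC//.
apply: filterS hc => y hy; exact: cmean_bound.
Qed.

End CircleMean.

Section TorusMean.
Context {R : realType} {n : nat}.
Implicit Types (th : 'rV[R]_n) (f g : 'rV[R]_n -> R) (s : seq 'I_n) (j : 'I_n).

Definition upd th j (t : R) : 'rV[R]_n := \row_k (if k == j then t else th 0 k).

(** It mirrors [iterated_circle_integral], in angles and normalised; [th] supplies the coordinates
    outside s. *)
Fixpoint tmean s g th : R :=
  if s is j :: s' then cmean (fun t => tmean s' g (upd th j t)) else g th.

Lemma upd_continuous j : continuous (fun z : 'rV[R]_n * R => upd z.1 j z.2).
Proof.
apply: rV_continuous => k.
rewrite (_ : (fun z => _) = (fun z : 'rV[R]_n * R => if k == j then z.2 else z.1 0 k)); last first.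
  by apply/funext => z; rewrite mxE.
case: eqP => _; first by move=> z; exact: cvg_snd.
apply: (cont_comp _ (@coord_continuous_rV R n k)).
by move=> z; exact: cvg_fst.
Qed.

Lemma tmean_continuous s g : continuous g -> continuous (tmean s g).
Proof.
elim: s g => [//|j s ih] g cg /=; apply: (cmean_param (G := fun th t => tmean s g (upd th j t))).
exact: (cont_comp (@upd_continuous j) (ih _ cg)).
Qed.

Lemma tmean_upd_continuous s g th j : continuous g ->
  continuous (fun t => tmean s g (upd th j t)).
Proof.
move=> cg; apply: (@cont_comp _ _ _ (fun t => upd th j t) (tmean s g)); last exact: tmean_continuous.
exact: (cont_comp (@pair_continuous _ _ th) (@upd_continuous j)).
Qed.

Lemma tmeanD s f g th : continuous f -> continuous g ->
  tmean s (fun x => f x + g x) th = tmean s f th + tmean s g th.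
Proof.
move=> cf cg; elim: s th => [//|j s ih] th /=.
rewrite -cmeanD; [|exact: tmean_upd_continuous..].
by congr cmean; apply/funext => t; exact: ih.
Qed.

Lemma tmeanZ s a g th : continuous g ->
  tmean s (fun x => a * g x) th = a * tmean s g th.
Proof.
move=> cg; elim: s th => [//|j s ih] th /=.
rewrite -cmeanZ; last exact: tmean_upd_continuous.
by congr cmean; apply/funext => t; exact: ih.
Qed.

Lemma tmean_sum s (I : Type) (r : seq I) (g : I -> 'rV[R]_n -> R) th :
  (forall i, continuous (g i)) ->
  tmean s (fun x => \sum_(i <- r) g i x) th = \sum_(i <- r) tmean s (g i) th.
Proof.
move=> cg; elim: r => [|i r ih].
  rewrite big_nil (_ : (fun x => _) = (fun=> 0)); last first.
    by apply/funext => x; rewrite big_nil.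
  elim: s th => [//|j s ih] th /=.
  by rewrite (_ : (fun t => _) = (fun=> 0)) ?cmean_cst//; apply/funext => t; exact: ih.
have cs := @sum_continuous R _ _ r xpredT g (fun i _ => cg i).
rewrite big_cons -ih -(tmeanD _ _ (cg i) cs).
by congr tmean; apply/funext => x; rewrite big_cons.
Qed.

Lemma tmean_near_cst s g (c e : R) th : continuous g ->
  (forall x, `|g x - c| <= e) -> `|tmean s g th - c| <= e.
Proof.
move=> cg h; elim: s th => [//|j s ih] th /=.
rewrite -[X in _ - X](cmean_cst c); apply: cmean_bound => //.
  exact: tmean_upd_continuous.
exact: contc.
Qed.

(** Averaging absorbs the shift in the coordinates of s only, so on the right it survives in the
    base point. *)
Lemma tmean_shift s g (a th : 'rV[R]_n) : continuous g ->
  (forall x j, g (x + 2 * pi *: delta_mx 0 j) = g x) ->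
  tmean s (fun x => g (x + a)) th = tmean s g (th + a).
Proof.
move=> cg per; elim: s th => [//|j s ih] th /=.
under eq_fun do rewrite ih.
have perT x k : tmean s g (x + 2 * pi *: delta_mx 0 k) = tmean s g x.
  elim: s {ih} x => [//|i s ih] x /=.
  have [<-|ik] := eqVneq k i.
    by congr cmean; apply/funext => t; congr tmean; apply/rowP => l;
      rewrite !mxE; case: eqP => //; rewrite ?mulr0 ?addr0.
  congr cmean; apply/funext => t; rewrite -[RHS]ih; congr tmean.
  apply/rowP => l; rewrite !mxE /=; case: (eqVneq l i) => // ->.
  by rewrite eq_sym (negPf ik) mulr0 addr0.
rewrite -[RHS](@cmean_shift _ _ (a 0 j)).
- congr cmean; apply/funext => t; congr tmean.
  by apply/rowP => k; rewrite !mxE; case: eqP => // ->.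
- exact: tmean_upd_continuous.
- move=> t; rewrite -[RHS](perT _ j); congr tmean.
  by apply/rowP => k; rewrite !mxE /=; case: eqP => _; rewrite ?mulr1 ?mulr0 ?addr0.
Qed.

Lemma tmean_dep s g th th' : (forall k, k \notin s -> th 0 k = th' 0 k) ->
  tmean s g th = tmean s g th'.
Proof.
elim: s th th' => [|j s ih] th th' h /=.
  by congr g; apply/rowP => k; exact: h.
congr cmean; apply/funext => t; apply: ih => k ks; rewrite !mxE.
by case: eqP => // /eqP kj; apply: h; rewrite inE negb_or kj.
Qed.

End TorusMean.

Local Notation Re := complex.Re.
Local Notation Im := complex.Im.
Local Notation "x %:C" := (real_complex _ x) : ring_scope.
Local Notation "R [i]" := (complex R) : type_scope.

(** * Laurent polynomials in polar coordinates *)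

Section Cis.
Context {R : realType}.
Implicit Types a b s t : R.

(* [cis a t] is exp (a + i t). *)
Definition cis a t : R[i] := circle_point (expR a) t.

Lemma cisE a t : cis a t = Complex (expR a * cos t) (expR a * sin t).
Proof. by []. Qed.

Lemma cisD a b s t : cis (a + b) (s + t) = cis a s * cis b t.
Proof.
rewrite !cisE expRD cosD sinD; apply/eqP; rewrite eq_complex /=.
by apply/andP; split; apply/eqP; ring.
Qed.

Lemma cis0 : cis 0 0 = 1.
Proof. by rewrite cisE expR0 cos0 sin0 mulr1 mulr0. Qed.

Lemma norm_cis a t : `|cis a t| = (expR a)%:C.
Proof.
rewrite normc_def /= !exprMn -mulrDr cos2Dsin2 mulr1 sqrtr_sqr.
by rewrite ger0_norm ?expR_ge0.
Qed.

Lemma cis_neq0 a t : cis a t != 0.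
Proof. by rewrite -normr_eq0 norm_cis eq_complex /= expR_eq0. Qed.

Lemma cisX a t k : cis a t ^+ k = cis (k%:R * a) (k%:R * t).
Proof.
elim: k => [|k ih]; first by rewrite expr0 !mul0r cis0.
by rewrite exprS ih -cisD -!nat1r !mulrDl !mul1r.
Qed.

Lemma cisN a t : cis (- a) (- t) = (cis a t)^-1.
Proof.
apply: (mulIf (cis_neq0 a t)); rewrite mulVf ?cis_neq0// -cisD.
by rewrite !addNr cis0.
Qed.

Lemma cisXz a t (k : int) : cis a t ^ k = cis (k%:~R * a) (k%:~R * t).
Proof.
case: k => k; first by rewrite -exprnP cisX.
by rewrite NegzE -exprnN cisX -cisN !mulrNz !mulNr.
Qed.

Lemma cis_sum (I : Type) (r : seq I) (f g : I -> R) :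
  \prod_(i <- r) cis (f i) (g i) = cis (\sum_(i <- r) f i) (\sum_(i <- r) g i).
Proof.
by elim: r => [|i r ih]; rewrite ?big_nil ?cis0// !big_cons ih cisD.
Qed.

Lemma cisD2pi a t : cis a (t + 2 * pi) = cis a t.
Proof. by rewrite !cisE mulr_natl cosD2pi sinD2pi. Qed.

Lemma cisD2piz a t (k : int) : cis a (t + k%:~R * (2 * pi)) = cis a t.
Proof.
have hn b s (m : nat) : cis b (s + m%:R * (2 * pi)) = cis b s.
  elim: m => [|m ih]; first by rewrite mul0r addr0.
  by rewrite -natr1 mulrDl mul1r addrA cisD2pi.
case: k => m; first exact: hn.
by rewrite NegzE mulrNz mulNr -[RHS](hn _ _ m.+1) -[LHS](hn _ _ m.+1) subrK hn.
Qed.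

Lemma cis_onto (z : R[i]) : z != 0 -> exists t, z = cis (ln (Re `|z|)) t.
Proof.
move=> z0; set r := Re `|z|.
have nz : `|z| = r%:C by rewrite /r normc_def.
have r0 : 0 < r by rewrite -ltcR -nz normr_gt0.
have e : expR (ln r) = r by apply/eqP; rewrite lnK_eq.
have zz : Re z ^+ 2 + Im z ^+ 2 = r ^+ 2.
  by apply: complexI; rewrite add_Re2_Im2 nz -rmorphXn.
set x := Re z / r; set y := Im z / r.
have xy : x ^+ 2 + y ^+ 2 = 1.
  by rewrite !exprMn -mulrDl zz exprVn divff// expf_neq0// gt_eqF.
have x1 : -1 <= x <= 1.
  by rewrite -ler_norml -(@ler_pXn2r _ 2) ?nnegrE// expr1n real_normK ?num_real// -xy lerDl sqr_ge0.
have ex : cos (acos x) = x by apply: acosK; rewrite in_itv.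
have ey : sin (acos x) = `|y| by rewrite sin_acos// -xy addrAC subrr add0r sqrtr_sqr.
have zE : z = Complex (r * x) (r * y).
  rewrite /x /y !(mulrC r) !divfK ?gt_eqF//; by case: z {z0 r nz r0 e zz x y xy x1 ex ey}.
have [y0|y0] := leP 0 y.
  by exists (acos x); rewrite cisE e ex ey ger0_norm.
by exists (- acos x); rewrite cisE e cosN sinN ex ey ltr0_norm// opprK.
Qed.

Lemma cis_primitive (N : nat) : (0 < N)%N ->
  N.-primitive_root (cis 0 (2 * pi / N%:R)).
Proof.
move=> N0.
have NR : (0 : R) < N%:R by rewrite ltr0n.
apply/andP; split => //; apply/forallP => -[k kN] /=.
rewrite unity_rootE cisX mulr0 mulrA; apply/eqP.
have [->|kN'] := eqVneq k.+1 N.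
  rewrite (_ : _ / _ = 2 * pi); last by field; rewrite gt_eqF.
  by rewrite -[2 * pi]add0r cisD2pi cis0 eqxx.
have lt_kN : (k.+1 < N)%N by rewrite ltn_neqAle kN' kN.
apply/negbTE; rewrite cisE expR0 !mul1r eq_complex /= negb_and.
apply/orP; left; rewrite lt_eqF//.
(* Half the angle lies strictly between 0 and pi, so cos (2 s) = 1 - 2 sin^2 s is less than 1. *)
set s : R := k.+1%:R * pi / N%:R.
have -> : k.+1%:R * (2 * pi) / N%:R = s *+ 2 by rewrite /s -mulr_natl; field; rewrite gt_eqF.
rewrite cos_mulr2n cos2sin2 mulrnBl addrAC -[1 *+ 2]/(1 + 1) addrK.
rewrite ltrBlDr ltrDl mulrn_wgt0// exprn_gt0// sin_gt0_pi//.
rewrite /s divr_gt0 ?mulr_gt0 ?pi_gt0 ?ltr0n//= ltr_pdivrMr// mulrC ltr_pM2l ?pi_gt0//.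
by rewrite ltr_nat.
Qed.

Lemma expR_power_unbounded (eta x : R) : 0 < eta ->
  exists2 N, (0 < N)%N & x <= expR eta ^+ N.
Proof.
move=> e0; exists (Num.trunc (x / eta)).+1 => //.
rewrite -expRM_natl; apply: le_trans (expR_ge1Dx _).
have h := truncnS_gt (x / eta).
rewrite ltr_pdivrMr// in h; apply: le_trans (ltW h) _.
by rewrite lerDr.
Qed.

End Cis.

Section GSum.
Context {R : realType} {n : nat}.
Implicit Types (f : laurent R n) (w th : 'rV[R]_n) (v al : 'rV[int]_n).

Definition rr al : 'rV[R]_n := map_mx intr al.

Definition idot al v : int := \sum_j al 0 j * v 0 j.

Lemma dot_rr al v : dot (rr al) (rr v) = (idot al v)%:~R.
Proof. by rewrite [RHS]raddf_sum; apply: eq_bigr => j _ /=; rewrite !mxE intrM. Qed.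

(** This is exp (w + i th), taken coordinate by coordinate. *)
Definition tpt w th : 'rV[R[i]]_n := \row_j cis (w 0 j) (th 0 j).

(** The weights c treat f itself (c = 1) and its derivatives z_j d_j f (c the j-th exponent) in one
    formula. *)
Definition gsum f (c : 'rV[int]_n -> int) w th : R[i] :=
  \sum_(al <- finsupp f) (c al)%:~R * f al * cis (dot (rr al) w) (dot (rr al) th).

Definition fval f w th : R[i] := gsum f (fun=> 1) w th.

(* sum_j v_j z_j (d_j f) / f at z = e^(w + i th). *)
Definition psi f v w th : R[i] := gsum f (idot v) w th / fval f w th.

Lemma laurent_monomial_tpt al w th :
  laurent_monomial al (tpt w th) = cis (dot (rr al) w) (dot (rr al) th).
Proof.
rewrite /laurent_monomial /dot -cis_sum.
by apply: eq_bigr => j _; rewrite !mxE cisXz.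
Qed.

Lemma laurent_eval_tpt f w th : laurent_eval f (tpt w th) = fval f w th.
Proof. by apply: eq_bigr => al _; rewrite laurent_monomial_tpt mul1r. Qed.

Lemma idot_delta al j : idot (delta_mx 0 j) al = al 0 j.
Proof.
rewrite /idot (bigD1 j)//= mxE !eqxx mul1r big1 ?addr0// => i /negPf h.
by rewrite mxE h andbF mul0r.
Qed.

Lemma laurent_partial_tpt f j w th :
  tpt w th 0 j * laurent_partial_eval j f (tpt w th) = gsum f (idot (delta_mx 0 j)) w th.
Proof.
rewrite /laurent_partial_eval mulr_sumr; apply: eq_bigr => al _.
have key (x : 'rV[R]_n) : x 0 j + dot (rr (al - delta_mx 0 j)) x = dot (rr al) x.
  rewrite /dot (bigD1 j)//= [RHS](bigD1 j)//= addrA; congr (_ + _).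
    by rewrite !mxE !eqxx intrB mulrBl mul1r addrC subrK.
  by apply: eq_bigr => i /negPf ij; rewrite !mxE ij andbF subr0.
by rewrite idot_delta mulrCA laurent_monomial_tpt mxE -cisD !key.
Qed.

Lemma Log_abs_tpt w th : Log_abs (tpt w th) = w.
Proof. by apply/rowP => j; rewrite !mxE norm_cis /= expRK. Qed.

Lemma amoebaP f w : amoeba f w <-> exists th, fval f w th = 0.
Proof.
split=> [[z [z0 fz] <-]|[th h]]; last first.
  exists (tpt w th); last exact: Log_abs_tpt.
  by split; [move=> j; rewrite mxE cis_neq0|rewrite laurent_eval_tpt].
have /choice [t ht] j := cis_onto (z0 j).
exists (\row_j t j); rewrite -laurent_eval_tpt (_ : tpt _ _ = z)//.
by apply/rowP => j; rewrite !mxE -ht.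
Qed.

Lemma gsum_periodic f c w th al : gsum f c w (th + 2 * pi *: rr al) = gsum f c w th.
Proof.
apply: eq_bigr => be _; rewrite dotDr dotZr dot_rr mulrC.
by rewrite [X in cis _ X]addrC mulrC [2 * pi * _]mulrC addrC cisD2piz.
Qed.

Lemma Re_sum (I : Type) (r : seq I) (F : I -> R[i]) :
  Re (\sum_(i <- r) F i) = \sum_(i <- r) Re (F i).
Proof. by apply: big_morph => // -[a b] [c d]. Qed.

Lemma Im_sum (I : Type) (r : seq I) (F : I -> R[i]) :
  Im (\sum_(i <- r) F i) = \sum_(i <- r) Im (F i).
Proof. by apply: big_morph => // -[a b] [c d]. Qed.

(** Real and imaginary parts are kept apart because [circle_integral] integrates them apart. *)
Lemma gsum_continuous f c :
  continuous (fun z : 'rV[R]_n * 'rV[R]_n => Re (gsum f c z.1 z.2)) /\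
  continuous (fun z : 'rV[R]_n * 'rV[R]_n => Im (gsum f c z.1 z.2)).
Proof.
have cw al : continuous (fun z : 'rV[R]_n * 'rV[R]_n => expR (dot (rr al) z.1)).
  apply: (@cont_comp _ _ _ (fun z => dot (rr al) z.1) expR); last exact: continuous_expR.
  by apply: (@cont_comp _ _ _ fst (dot (rr al))); [move=> z; exact: cvg_fst|exact: dot_continuous].
have ct al : continuous (fun z : 'rV[R]_n * 'rV[R]_n => dot (rr al) z.2).
  by apply: (@cont_comp _ _ _ snd (dot (rr al))); [move=> z; exact: cvg_snd|exact: dot_continuous].
have cc al := cont_comp (ct al) (@continuous_cos R).
have cs al := cont_comp (ct al) (@continuous_sin R).
split.
- rewrite (_ : (fun z => _) = fun z : 'rV[R]_n * 'rV[R]_n => \sum_(al <- finsupp f)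
    (Re ((c al)%:~R * f al) * (expR (dot (rr al) z.1) * cos (dot (rr al) z.2))
     - Im ((c al)%:~R * f al) * (expR (dot (rr al) z.1) * sin (dot (rr al) z.2)))); last first.
    apply/funext => z; rewrite Re_sum; apply: eq_bigr => al _.
    by rewrite cisE; case: (_ * f al).
  apply: (@sum_continuous _ _ _ _ _ (fun al (z : 'rV[R]_n * 'rV[R]_n) =>
    Re ((c al)%:~R * f al) * (expR (dot (rr al) z.1) * cos (dot (rr al) z.2))
     - Im ((c al)%:~R * f al) * (expR (dot (rr al) z.1) * sin (dot (rr al) z.2)))) => al _.
  by apply: contB; (apply: contM; first exact: contc); apply: contM.
- rewrite (_ : (fun z => _) = fun z : 'rV[R]_n * 'rV[R]_n => \sum_(al <- finsupp f)
    (Re ((c al)%:~R * f al) * (expR (dot (rr al) z.1) * sin (dot (rr al) z.2))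
     + Im ((c al)%:~R * f al) * (expR (dot (rr al) z.1) * cos (dot (rr al) z.2)))); last first.
    apply/funext => z; rewrite Im_sum; apply: eq_bigr => al _.
    by rewrite cisE; case: (_ * f al).
  apply: (@sum_continuous _ _ _ _ _ (fun al (z : 'rV[R]_n * 'rV[R]_n) =>
    Re ((c al)%:~R * f al) * (expR (dot (rr al) z.1) * sin (dot (rr al) z.2))
     + Im ((c al)%:~R * f al) * (expR (dot (rr al) z.1) * cos (dot (rr al) z.2)))) => al _.
  by apply: contD; (apply: contM; first exact: contc); apply: contM.
Qed.

Lemma psi_continuous f v w th : fval f w th != 0 ->
  {for (w, th), continuous (fun z : 'rV[R]_n * 'rV[R]_n => Re (psi f v z.1 z.2))} /\
  {for (w, th), continuous (fun z : 'rV[R]_n * 'rV[R]_n => Im (psi f v z.1 z.2))}.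
Proof.
move=> f0.
have [rN iN] := gsum_continuous f (idot v); have [rD iD] := gsum_continuous f (fun=> 1).
pose D (z : 'rV[R]_n * 'rV[R]_n) : R :=
  (Re (fval f z.1 z.2)) * (Re (fval f z.1 z.2)) + Im (fval f z.1 z.2) * Im (fval f z.1 z.2).
have cD : continuous D by apply: contD; apply: contM.
have D0 : D (w, th) != 0.
  rewrite /D /= -!expr2 paddr_eq0 ?sqr_ge0// !sqrf_eq0 negb_and.
  by move: f0; rewrite eq_complex negb_and.
have cDV : {for (w, th), continuous (fun z => (D z)^-1)}.
  by apply: continuousV => //; exact: cD.
split.
- rewrite (_ : (fun z => _) = fun z : 'rV[R]_n * 'rV[R]_n =>
    (Re (gsum f (idot v) z.1 z.2) * Re (fval f z.1 z.2) +
     Im (gsum f (idot v) z.1 z.2) * Im (fval f z.1 z.2)) * (D z)^-1); last first.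
    apply/funext => z; rewrite /psi /D -!expr2.
    by case: (gsum _ _ _ _) => a b; case: (fval _ _ _) => c d /=; ring.
  apply: continuousM => //.
  by apply: (contD (f := fun z => _) (g := fun z => _)); apply: contM.
- rewrite (_ : (fun z => _) = fun z : 'rV[R]_n * 'rV[R]_n =>
    (Im (gsum f (idot v) z.1 z.2) * Re (fval f z.1 z.2) -
     Re (gsum f (idot v) z.1 z.2) * Im (fval f z.1 z.2)) * (D z)^-1); last first.
    apply/funext => z; rewrite /psi /D -!expr2.
    by case: (gsum _ _ _ _) => a b; case: (fval _ _ _) => c d /=; ring.
  apply: continuousM => //.
  by apply: (contB (f := fun z => _) (g := fun z => _)); apply: contM.
Qed.

(* Only angles in [0, 2 pi]^n matter, and these form a compact set. *)
Lemma amoeba_closed f : closed (amoeba f).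
Proof.
rewrite -[amoeba f]setCK; apply: open_closedC; rewrite openE => w Aw.
pose T : set 'rV[R]_n := [set th | forall j, `[0, 2 * pi]%classic (th 0 j)].
have cT : compact T.
  exact: (@rV_compact R _ (fun=> `[0, 2 * pi]%classic) (fun=> @segment_compact _ _ _)).
have fT w' : (forall th, T th -> fval f w' th != 0) -> ~ amoeba f w'.
  move=> h /amoebaP [th hth].
  (* The number of full turns to take off to bring the angle into [0, 2 pi]. *)
  pose k j : int := Num.floor (th 0 j / (2 * pi)).
  have := h (th + 2 * pi *: rr (\row_j - k j)).
  rewrite /fval gsum_periodic -/(fval _ _ _) hth eqxx.
  move=> H; suff /H : T (th + 2 * pi *: rr (\row_j - k j)) by [].
  move=> j; rewrite /= in_itv /= !mxE intrN mulrN.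
  have tp := @twopi_gt0 R; have /andP[h1 h2] := floor_itv (th 0 j / (2 * pi)).
  rewrite -/(k j) in h1 h2; rewrite ler_pdivlMr// in h1.
  rewrite ltr_pdivrMr// intrD mulrDl mul1r in h2.
  by apply/andP; split; lra.
have := cT; move=> /compact_near_coveringP /(_ _ (nbhs w) (fun w' th => fval f w' th != 0) _) h.
have : \forall w' \near w, T `<=` (fun th => fval f w' th != 0).
  apply: h => th _.
  have [cr ci] := gsum_continuous f (fun=> 1).
  have f0 : fval f w th != 0 by apply/eqP => h; apply: Aw; apply/amoebaP; exists th.
  have h : \forall z \near (w, th), fval f z.1 z.2 != 0.
    move: f0; rewrite eq_complex negb_and => /orP[h|h].
      have hh := cr (w, th) [set x | x != 0] (open_nbhs_nbhs (conj (@open_neq _ 0) h)).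
      apply: (@filterS _ (nbhs (w, th)) _ _ _ _ hh) => z /=;
        by rewrite eq_complex negb_and => ->.
    have hh := ci (w, th) [set x | x != 0] (open_nbhs_nbhs (conj (@open_neq _ 0) h)).
    apply: (@filterS _ (nbhs (w, th)) _ _ _ _ hh) => z /=;
      by rewrite eq_complex negb_and => ->; rewrite orbT.
  case: h => -[U V] /= [nU nV] UV; exists (V, U) => //= -[th' w'] [/= Vt Uw].
  exact: (UV (w', th') (conj Uw Vt)).
by apply: filterS => w' h'; apply: fT.
Qed.

End GSum.

(** * Zeros along one-parameter families *)

Section Winding.
Context {R : realType} {n : nat}.
Implicit Types (f : laurent R n) (w th : 'rV[R]_n) (v al : 'rV[int]_n).

(* The restriction of f to the one-parameter family u |-> u ^ v . z, cleared
   of denominators by the power u ^ (shift f v). *)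
Definition shift f v : nat := (\sum_(al <- finsupp f) `|idot al v|)%N.

(** On the support the integer is non-negative, since [shift] bounds every [|idot al v|]; there
    [absz] only changes its type. *)
Definition sexp f v al : nat := absz (idot al v + (shift f v)%:Z).

Definition lpoly f v w th : {poly R[i]} :=
  \sum_(al <- finsupp f)
    (f al * cis (dot (rr al) w) (dot (rr al) th)) *: 'X^(sexp f v al).

Lemma abs_idot_le f v al : al \in finsupp f -> (`|idot al v| <= shift f v)%N.
Proof. by move=> h; rewrite /shift (big_rem al)//= leq_addr. Qed.

Lemma sexpE f v al : al \in finsupp f ->
  (sexp f v al)%:Z = idot al v + (shift f v)%:Z.
Proof. by move=> /(abs_idot_le v); rewrite /sexp; lia. Qed.

Lemma size_lpoly f v w th : (size (lpoly f v w th) <= ((shift f v).*2).+1)%N.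
Proof.
rewrite /lpoly big_seq; elim/big_ind: _ => [|p q hp hq|al h].
- by rewrite size_poly0.
- by apply: leq_trans (size_polyD _ _) _; rewrite geq_max hp.
- apply: leq_trans (size_scale_leq _ _) _; rewrite size_polyXn ltnS.
  by have := abs_idot_le v h; have := sexpE v h; lia.
Qed.

Lemma idotC al v : idot al v = idot v al.
Proof. by apply: eq_bigr => i _; rewrite mulrC. Qed.

Lemma dot_tZ (t : R) al w v : dot (rr al) (w + t *: rr v) = dot (rr al) w + t * (idot al v)%:~R.
Proof. by rewrite dotDr dotZr dot_rr. Qed.

Lemma cis_sexp f v al a t : al \in finsupp f ->
  cis a t ^+ sexp f v al =
  cis (a * (idot al v)%:~R) (t * (idot al v)%:~R) * cis a t ^+ shift f v :> R[i].
Proof.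
move=> h; have e : (sexp f v al)%:R = (idot al v)%:~R + (shift f v)%:R :> R.
  by rewrite -[LHS]/((sexp f v al)%:Z%:~R) sexpE// intrD.
by rewrite !cisX e -cisD !mulrDl ![_ * (idot _ _)%:~R]mulrC.
Qed.

Lemma lpoly_eval f v w th a t :
  (lpoly f v w th).[cis a t] = fval f (w + a *: rr v) (th + t *: rr v) * cis a t ^+ shift f v.
Proof.
rewrite /lpoly horner_sum mulr_suml big_seq [RHS]big_seq; apply: eq_bigr => al h.
by rewrite hornerZ hornerXn cis_sexp// mulr1z mul1r !dot_tZ cisD !mulrA.
Qed.

Lemma lpoly_deriv f v w th a t :
  cis a t * (lpoly f v w th)^`().[cis a t] =
  (gsum f (idot v) (w + a *: rr v) (th + t *: rr v)
   + (shift f v)%:R * fval f (w + a *: rr v) (th + t *: rr v)) * cis a t ^+ shift f v.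
Proof.
rewrite /fval /gsum mulr_sumr -big_split mulr_suml /lpoly raddf_sum horner_sum mulr_sumr.
rewrite big_seq [RHS]big_seq; apply: eq_bigr => al h /=.
rewrite derivZ derivXn hornerZ hornerMn hornerXn.
have -> : cis a t * (f al * cis (dot (rr al) w) (dot (rr al) th) * (cis a t ^+ (sexp f v al).-1 *+ sexp f v al))
    = f al * cis (dot (rr al) w) (dot (rr al) th) * ((sexp f v al)%:R * cis a t ^+ sexp f v al).
  case: (sexp f v al) => [|k]; first by rewrite mulr0n !mul0r !mulr0.
  by rewrite exprS -mulr_natl; ring.
have e : (sexp f v al)%:R = (idot al v)%:~R + (shift f v)%:R :> R[i].
  by rewrite -[LHS]/((sexp f v al)%:Z%:~R) sexpE// intrD.
rewrite e cis_sexp// !dot_tZ cisD (idotC v) mulr1z mul1r.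
move: (cis (dot (rr al) w) _) (cis (a * _) _) (cis a t ^+ _) ((idot al v)%:~R : R[i])
  ((shift f v)%:R : R[i]) (f al) => A B U I K c.
by ring.
Qed.

(** Multiplying by [u ^+ shift f v] to clear denominators adds the constant [shift f v] to the
    logarithmic derivative u P' / P. *)
Lemma lpoly_psi f v w th a t : fval f (w + a *: rr v) (th + t *: rr v) != 0 ->
  psi f v (w + a *: rr v) (th + t *: rr v) =
  cis a t * (lpoly f v w th)^`().[cis a t] / (lpoly f v w th).[cis a t] - (shift f v)%:R.
Proof.
move=> f0; rewrite lpoly_deriv lpoly_eval /psi.
have : cis a t ^+ shift f v != 0 by rewrite expf_neq0 ?cis_neq0.
move: f0 (_ ^+ _) ((shift f v)%:R : R[i]).
move: (gsum f _ _ _) (fval f _ _) => g h h0 U K U0.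
by field; rewrite h0 U0.
Qed.

Definition lroots f v w th : seq R[i] := sval (closed_field_poly_normal (lpoly f v w th)).

Lemma lrootsE f v w th :
  lpoly f v w th = lead_coef (lpoly f v w th) *: \prod_(z <- lroots f v w th) ('X - z%:P).
Proof. by rewrite /lroots; case: closed_field_poly_normal. Qed.

Lemma lpoly_neq0 f v w th a t : fval f (w + a *: rr v) (th + t *: rr v) != 0 ->
  lpoly f v w th != 0.
Proof.
apply: contraNneq => h; have := lpoly_eval f v w th a t.
by rewrite h horner0 => /esym/eqP; rewrite mulf_eq0 expf_eq0 (negPf (cis_neq0 _ _)) andbF orbF.
Qed.

Lemma size_lroots f v w th : lpoly f v w th != 0 ->
  (size (lroots f v w th) <= (shift f v).*2)%N.
Proof.
move=> h; have := size_lpoly f v w th.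
by rewrite {1}lrootsE size_scale ?lead_coef_eq0// size_prod_XsubC ltnS.
Qed.

Lemma mem_lroots f v w th a t : lpoly f v w th != 0 ->
  (cis a t \in lroots f v w th) = (fval f (w + a *: rr v) (th + t *: rr v) == 0).
Proof.
move=> h; rewrite -root_prod_XsubC.
have -> : root (\prod_(z <- lroots f v w th) ('X - z%:P)) (cis a t) = root (lpoly f v w th) (cis a t).
  by rewrite [in RHS]lrootsE rootZ ?lead_coef_eq0.
by rewrite rootE lpoly_eval mulf_eq0 expf_eq0 (negPf (cis_neq0 _ _)) andbF orbF.
Qed.

(* Zeros minus poles of u |-> f (u ^ v . e^(w + i th)) in the disc |u| < e^a. *)
Definition wind f v w th (a : R) : R :=
  (count (fun z => `|z| < (expR a)%:C) (lroots f v w th))%:R - (shift f v)%:R.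

(** In the variable u, a Riemann sum over the N-th roots of unity for Cauchy's integral of zeros
    minus poles. *)
Definition psi_avg f v w th (N : nat) : R[i] :=
  N%:R^-1 * \sum_(k < N) psi f v w (th + (2 * pi / N%:R * k%:R) *: rr v).

(** A root of modulus e^b puts [w + b *: rr v] in the amoeba. A window of half-width eta around a
    that misses the amoeba is therefore an annulus of ratio e^eta free of roots. *)
Lemma psi_avg_wind f v w th (a eta : R) (N : nat) : (0 < N)%N -> 0 < eta ->
  2 <= expR eta ^+ N ->
  (forall b, `|b - a| < eta -> ~ amoeba f (w + b *: rr v)) ->
  `|psi_avg f v (w + a *: rr v) th N - (wind f v w th a)%:C| <=
    ((shift f v).*2%:R * (2 * expR eta ^- N))%:C.
Proof.
move=> N0 e0 hN hA.
have fa t : fval f (w + a *: rr v) (th + t *: rr v) != 0.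
  apply/eqP => h; apply: (hA a); first by rewrite subrr normr0.
  by apply/amoebaP; exists (th + t *: rr v).
have P0 := lpoly_neq0 (fa 0).
set r : R[i] := cis a 0.
set zeta : R[i] := cis 0 (2 * pi / N%:R).
have rz k : r * zeta ^+ k = cis a (2 * pi / N%:R * k%:R).
  by rewrite /r /zeta cisX mulr0 -cisD addr0 add0r mulrC.
have := @root_count_approx _ (lroots f v w th) (lead_coef (lpoly f v w th)) r
  (expR eta)%:C N zeta (@cis_primitive R N N0) _ _ _ _ _.
rewrite /= -lrootsE -rmorphXn /= => h.
have {h} : `|N%:R^-1 * (\sum_(k < N) r * zeta ^+ k * (lpoly f v w th)^`().[r * zeta ^+ k]
     / (lpoly f v w th).[r * zeta ^+ k])
    - (count (fun z => `|z| < `|r|) (lroots f v w th))%:R|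
    <= (size (lroots f v w th))%:R * (2 * (expR eta ^+ N)%:C^-1).
  apply: h.
  - by rewrite lead_coef_eq0.
  - exact: cis_neq0.
  - by rewrite -[1]/(1%:C) ltcR expR_gt1.
  - have -> : 2 = (2 : R)%:C by rewrite rmorph_nat.
    by rewrite lecR.
  move=> z zs; have [->|z0] := eqVneq z 0; first by left; rewrite normr0 mul0r normr_ge0.
  have [t zt] := cis_onto z0; set b := ln _ in zt.
  rewrite zt mem_lroots// in zs.
  have hb : eta <= `|b - a|.
    rewrite leNgt; apply/negP => /hA; apply; apply/amoebaP; exists (th + t *: rr v); exact/eqP.
  rewrite zt /r !norm_cis -!rmorphM -!expRD !lecR !ler_expR.
  by move: hb; rewrite ler_normr => /orP[?|?]; [right|left]; lra.
have -> : N%:R^-1 * (\sum_(k < N) r * zeta ^+ k * (lpoly f v w th)^`().[r * zeta ^+ k]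
     / (lpoly f v w th).[r * zeta ^+ k]) = psi_avg f v (w + a *: rr v) th N + (shift f v)%:R.
  rewrite /psi_avg; under [in RHS]eq_bigr do rewrite lpoly_psi// -rz.
  rewrite sumrB sumr_const card_ord -(mulr_natl (shift f v)%:R) mulrBr mulKf ?subrK//.
  by rewrite pnatr_eq0 -lt0n.
rewrite /r norm_cis => h.
have -> : psi_avg f v (w + a *: rr v) th N - (wind f v w th a)%:C =
   psi_avg f v (w + a *: rr v) th N + (shift f v)%:R -
     (count (fun z => `|z| < (expR a)%:C) (lroots f v w th))%:R.
  by rewrite /wind rmorphB !rmorph_nat opprB addrA addrAC.
apply: le_trans h _; rewrite !rmorphM fmorphV /= !rmorph_nat ler_wpM2r//.
  by rewrite mulr_ge0// invr_ge0 -[0]/(0%:C) lecR exprn_ge0// expR_ge0.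
by rewrite ler_nat size_lroots.
Qed.

Lemma real_bounds_of_normC (z : R[i]) (x e : R) : `|z - x%:C| <= e%:C ->
  `|Re z - x| <= e /\ `|Im z| <= e.
Proof.
case: z => p q; rewrite normc_def /= lecR subr0 => h.
have e0 : 0 <= e by apply: le_trans h; exact: sqrtr_ge0.
have h2 : (p - x) ^+ 2 + q ^+ 2 <= e ^+ 2.
  rewrite -[leLHS]sqr_sqrtr ?addr_ge0 ?sqr_ge0// lerXn2r ?nnegrE ?sqrtr_ge0//.
split; rewrite -(@ler_pXn2r _ 2) ?nnegrE// real_normK ?num_real//; apply: le_trans h2.
  by rewrite lerDl sqr_ge0.
by rewrite lerDr sqr_ge0.
Qed.

(** One N serves all w, th and a, because the number of roots is at most twice [shift f v] whatever
    they are. *)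
Lemma psi_avg_uniform f v (eta e : R) : 0 < eta -> 0 < e ->
  exists2 N, (0 < N)%N & forall w th a,
  (forall b, `|b - a| < eta -> ~ amoeba f (w + b *: rr v)) ->
  `|Re (psi_avg f v (w + a *: rr v) th N) - wind f v w th a| <= e /\
  `|Im (psi_avg f v (w + a *: rr v) th N)| <= e.
Proof.
move=> eta0 e0.
have [N N0 hN] := expR_power_unbounded (Num.max 2 ((shift f v).*2%:R * 2 / e)) eta0.
rewrite ge_max in hN; case/andP: hN => hN1 hN2.
exists N => // w th a hA; apply: real_bounds_of_normC.
apply: le_trans (psi_avg_wind th N0 eta0 hN1 hA) _; rewrite lecR.
rewrite mulrA ler_pdivrMr ?exprn_gt0 ?expR_gt0//.
by rewrite ler_pdivrMr// in hN2; rewrite [leRHS]mulrC.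
Qed.

(** Winding numbers are integers, so approximation is enough to identify them. *)
Lemma wind_eq f v w th a w' th' a' : `|wind f v w th a - wind f v w' th' a'| < 1 ->
  wind f v w th a = wind f v w' th' a'.
Proof.
rewrite /wind; set p := count _ _; set q := count _ _ => h.
suff -> : p = q by [].
apply/eqP; rewrite eq_le; apply: contraT.
rewrite negb_and -!ltnNge => pq; move: h; rewrite ltNge => /negP; case.
have -> : p%:R - (shift f v)%:R - (q%:R - (shift f v)%:R) = p%:R - q%:R :> R by ring.
rewrite ler_normr; case/orP: pq => pq; apply/orP; [left|right].
  by rewrite lerBrDr nat1r ler_nat.
by rewrite opprB lerBrDr nat1r ler_nat.
Qed.

End Winding.

(** * The order as a number of zeros *)

Lemma locally_constant_connected (T : topologicalType) (U : Type) (A : set T) (g : T -> U) :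
  connected A -> (forall x, A x -> \forall y \near x, g y = g x) ->
  forall x y, A x -> A y -> g x = g y.
Proof.
move=> cA hg x y Ax Ay; pose S := [set z | g z = g x].
have : A `&` S = A.
  apply: cA; first by exists x.
  - exists (S°); first exact: open_interior.
    apply/seteqP; split => z [Az Sz]; split => //; last exact: interior_subset Sz.
    by apply: filterS (hg z Az) => u; rewrite /S /= => ->.
  - exists (~` (~` S)°); first by apply: open_closedC; exact: open_interior.
    apply/seteqP; split => z [Az Sz]; split => //.
      by move=> /interior_subset; apply.
    apply: contrapT => nS; apply: Sz.
    by apply: filterS (hg z Az) => u; rewrite /S /= => ->.
move=> e; have : (A `&` S) y by rewrite e.
by move=> [_ /esym].
Qed.

Lemma cont_pair (T U V : topologicalType) (f : T -> U) (g : T -> V) :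
  continuous f -> continuous g -> continuous (fun x => (f x, g x)).
Proof.
move=> cf cg x W [[A B] [/= nA nB] AB].
have hA : \forall y \near x, A (f y) := cf x _ nA.
have hB : \forall y \near x, B (g y) := cg x _ nB.
by apply: filterS2 hA hB => y Ay By; apply: (AB (f y, g y)).
Qed.

Lemma sum_continuous_at (R : realType) (T : topologicalType) (I : Type) (r : seq I)
    (f : I -> T -> R) (x : T) : (forall i, {for x, continuous (f i)}) ->
  {for x, continuous (fun y => \sum_(i <- r) f i y)}.
Proof.
move=> cf; apply: (@cvg_big _ _ _ _ xpredT (@add_continuous R^o) _ (nbhs x)) => i _.
exact: cf.
Qed.

Section OrderWinding.
Context {R : realType} {n : nat}.
Implicit Types (f : laurent R n) (w th : 'rV[R]_n) (v al : 'rV[int]_n).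

Lemma Re_psi_avg f v w th N : Re (psi_avg f v w th N) =
  N%:R^-1 * \sum_(k < N) Re (psi f v w (th + (2 * pi / N%:R * k%:R) *: rr v)).
Proof.
rewrite -Re_sum /psi_avg.
have -> : N%:R^-1 = (N%:R^-1)%:C :> R[i] by rewrite fmorphV rmorph_nat.
by case: (\sum_(_ < _) _) => a b /=; rewrite mul0r subr0.
Qed.

Lemma Im_psi_avg f v w th N : Im (psi_avg f v w th N) =
  N%:R^-1 * \sum_(k < N) Im (psi f v w (th + (2 * pi / N%:R * k%:R) *: rr v)).
Proof.
rewrite -Im_sum /psi_avg.
have -> : N%:R^-1 = (N%:R^-1)%:C :> R[i] by rewrite fmorphV rmorph_nat.
by case: (\sum_(_ < _) _) => a b /=; rewrite mul0r addr0.
Qed.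

Lemma fval_neq0 f w th : ~ amoeba f w -> fval f w th != 0.
Proof. by move=> Aw; apply/eqP => h; apply: Aw; apply/amoebaP; exists th. Qed.

Lemma complement_ball f w : ~ amoeba f w ->
  exists2 d, 0 < d & forall w', `|w' - w| < d -> ~ amoeba f w'.
Proof.
move=> Aw; have : nbhs w (~` amoeba f).
  by apply: open_nbhs_nbhs; split => //; exact/closed_openC/amoeba_closed.
move=> /nbhs_ballP [d /= d0 hd]; exists d => // w' hw'.
by apply: hd; rewrite -ball_normE /= distrC.
Qed.

Lemma direction_scale v (d : R) : 0 < d ->
  exists2 eta, 0 < eta & forall b, `|b| < eta -> `|b *: (rr v : 'rV[R]_n)| < d.
Proof.
move=> d0; have c0 : 0 < `|rr v : 'rV[R]_n| + 1 by rewrite ltr_wpDl.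
exists (d / (`|rr v : 'rV[R]_n| + 1)); first exact: divr_gt0.
move=> b; rewrite ltr_pdivlMr// normrZ => h; apply: le_lt_trans h.
by rewrite mulrDr mulr1 lerDl.
Qed.

(** With one N valid near w, [wind] is everywhere within 1/4 of [psi_avg], which is continuous and
    varies by less than 1/4; the total stays below 1. *)
Lemma wind_locally_constant f v w th : ~ amoeba f w ->
  \forall z \near (w, th), wind f v z.1 z.2 0 = wind f v w th 0.
Proof.
move=> Aw; have [d d0 hd] := complement_ball Aw.
have d20 : 0 < d / 2 by rewrite divr_gt0.
have [eta eta0 heta] := direction_scale v d20.
have e4 : 0 < 4^-1 :> R by rewrite invr_gt0.
have [N N0 hN] := psi_avg_uniform f v eta0 e4.
have key w' th' : `|w' - w| < d / 2 ->
    `|Re (psi_avg f v w' th' N) - wind f v w' th' 0| <= 4^-1.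
  move=> hw'; have [b|+ _] := hN w' th' 0; last by rewrite scale0r addr0.
  rewrite subr0 => /heta hb; apply: hd; rewrite addrAC [d]splitr.
  by apply: le_lt_trans (ler_normD _ _) _; exact: ltrD.
have cR : {for (w, th), continuous (fun z : 'rV[R]_n * 'rV[R]_n => Re (psi_avg f v z.1 z.2 N))}.
  rewrite (_ : (fun z => _) = fun z : 'rV[R]_n * 'rV[R]_n => N%:R^-1 *
     \sum_(k < N) Re (psi f v z.1 (z.2 + (2 * pi / N%:R * k%:R) *: rr v))); last first.
    by apply/funext => z; rewrite Re_psi_avg.
  apply: continuousM; first exact: cst_continuous.
  apply: (@sum_continuous_at _ _ _ _ (fun (k : 'I_N) (z : 'rV[R]_n * 'rV[R]_n) =>
    Re (psi f v z.1 (z.2 + (2 * pi / N%:R * k%:R) *: rr v)))) => k.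
  have [h _] := psi_continuous v (fval_neq0 (th + (2 * pi / N%:R * k%:R) *: rr v) Aw).
  pose sh (z : 'rV[R]_n * 'rV[R]_n) := (z.1, z.2 + (2 * pi / N%:R * k%:R) *: (rr v : 'rV[R]_n)).
  suff csh : continuous sh.
    exact: (@continuous_comp _ _ _ sh (fun z => Re (psi f v z.1 z.2)) (w, th) (csh (w, th)) h).
  apply: cont_pair; first by move=> z; exact: cvg_fst.
  apply: rV_continuous => i.
  rewrite (_ : (fun z => _) = fun z : 'rV[R]_n * 'rV[R]_n =>
    z.2 0 i + ((2 * pi / N%:R * k%:R) *: rr v) 0 i); last first.
    by apply/funext => z; rewrite mxE.
  apply: contD; last exact: contc.
  by apply: (cont_comp _ (@coord_continuous_rV R n i)) => z; exact: cvg_snd.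
have n1 : \forall z \near (w, th), `|Re (psi_avg f v w th N) - Re (psi_avg f v z.1 z.2 N)| < 4^-1.
  by move/cvgrPdist_lt : cR; apply.
have n2 : \forall z \near (w, th), `|z.1 - w| < d / 2.
  exists ([set w' | `|w' - w| < d / 2], setT) => //=; last by move=> [w' th'] [].
  split; last exact: filterT.
  apply/nbhs_ballP; exists (d / 2) => // w'.
  by rewrite -ball_normE /= distrC.
apply: (@filterS2 _ (nbhs (w, th)) _ _ _ _ _ n1 n2) => -[w' th'] /= h1 h2.
apply: wind_eq.
have k1 := key w' th' h2; have k2 := key w th _.
rewrite subrr normr0 in k2; have {}k2 := k2 d20.
by move: h1 k1 k2; rewrite !ltr_norml !ler_norml => /andP[? ?] /andP[? ?] /andP[? ?]; apply/andP; split; lra.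
Qed.

Lemma wind_angle f v w th th' : ~ amoeba f w -> wind f v w th 0 = wind f v w th' 0.
Proof.
move=> Aw; pose g (t : R) := wind f v w (th + t *: (th' - th)) 0.
have -> : wind f v w th 0 = g 0 by rewrite /g scale0r addr0.
have -> : wind f v w th' 0 = g 1 by rewrite /g scale1r addrC subrK.
apply: (locally_constant_connected (@segment_connected R 0 1)); last 2 first.
- by rewrite /= in_itv /= lexx ler01.
- by rewrite /= in_itv /= lexx ler01.
move=> t _; have c : continuous (fun t : R => (w, th + t *: (th' - th))).
  apply: cont_pair; first exact: cst_continuous.
  apply: rV_continuous => i; rewrite (_ : (fun t => _) = fun t => th 0 i + t * (th' - th) 0 i); last first.
    by apply/funext => s; rewrite !mxE.
  apply: contD; first exact: contc.
  by apply: contM; [move=> s; exact: cvg_id|exact: contc].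
exact: (c t _ (wind_locally_constant v _ Aw)).
Qed.

Lemma psi_periodic f v w th j : psi f v w (th + 2 * pi *: delta_mx 0 j) = psi f v w th.
Proof.
have -> : delta_mx 0 j = rr (delta_mx 0 j) :> 'rV[R]_n.
  by apply/rowP => i; rewrite !mxE; case: (_ && _).
by rewrite /psi /fval !gsum_periodic.
Qed.

Lemma Re_psi_continuous f v w : ~ amoeba f w -> continuous (fun th => Re (psi f v w th)).
Proof.
move=> Aw th; have [h _] := psi_continuous v (fval_neq0 th Aw).
exact: (@continuous_comp _ _ _ (fun th => (w, th)) (fun z => Re (psi f v z.1 z.2)) th (@pair_continuous _ _ w th) h).
Qed.

Lemma Im_psi_continuous f v w : ~ amoeba f w -> continuous (fun th => Im (psi f v w th)).
Proof.
move=> Aw th; have [_ h] := psi_continuous v (fval_neq0 th Aw).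
exact: (@continuous_comp _ _ _ (fun th => (w, th)) (fun z => Im (psi f v z.1 z.2)) th (@pair_continuous _ _ w th) h).
Qed.

(** All N translates have the same mean. As every coordinate is averaged, the shifted base point
    does not matter. *)
Lemma tmean_shifts (g : 'rV[R]_n -> R) (N : nat) (a : nat -> 'rV[R]_n) th :
  (0 < N)%N -> continuous g ->
  (forall x j, g (x + 2 * pi *: delta_mx 0 j) = g x) ->
  tmean (enum 'I_n) (fun x => N%:R^-1 * \sum_(k < N) g (x + a k)) th = tmean (enum 'I_n) g th.
Proof.
move=> N0 cg per.
have cgk k : continuous (fun x : 'rV[R]_n => g (x + a k)).
  apply: (cont_comp _ cg); apply: rV_continuous => i.
  rewrite (_ : (fun x => _) = fun x : 'rV[R]_n => x 0 i + a k 0 i); last first.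
    by apply/funext => s; rewrite !mxE.
  by apply: contD; [exact: coord_continuous_rV|exact: contc].
rewrite tmeanZ; last exact: (@sum_continuous _ _ _ _ _ (fun (k : 'I_N) (x : 'rV[R]_n) => g (x + a k))).
rewrite (tmean_sum _ _ _ (fun k : 'I_N => cgk k)).
rewrite (eq_bigr (fun=> tmean (enum 'I_n) g th)); last first.
  move=> k _; rewrite tmean_shift//; apply: tmean_dep => i.
  by rewrite mem_enum.
by rewrite sumr_const card_ord -(mulr_natl (tmean _ _ _)) mulKf// pnatr_eq0 -lt0n.
Qed.

(** By [tmean_shifts], [psi] may be replaced by [psi_avg], which for suitable N is within e of
    [wind] uniformly in the angle. *)
Lemma tmean_psi f v w th th' : ~ amoeba f w ->
  tmean (enum 'I_n) (fun x => Re (psi f v w x)) th = wind f v w th' 0 /\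
  tmean (enum 'I_n) (fun x => Im (psi f v w x)) th = 0.
Proof.
move=> Aw.
suff h e : 0 < e ->
   `|tmean (enum 'I_n) (fun x => Re (psi f v w x)) th - wind f v w th' 0| <= e /\
   `|tmean (enum 'I_n) (fun x => Im (psi f v w x)) th - 0| <= e.
  by split; apply/eqP; rewrite -subr_eq0 -normr_eq0 eq_le normr_ge0 andbT;
    apply/ler_addgt0Pl => e /h[h1 h2]; rewrite addr0.
move=> e0; have [d d0 hd] := complement_ball Aw.
have [eta eta0 heta] := direction_scale v d0.
have [N N0 hN] := psi_avg_uniform f v eta0 e0.
have key x : `|Re (psi_avg f v w x N) - wind f v w th' 0| <= e /\
    `|Im (psi_avg f v w x N) - 0| <= e.
  rewrite (wind_angle v th' x Aw) subr0.
  have [b|] := hN w x 0; last by rewrite scale0r addr0.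
  by rewrite subr0 => /heta hb; apply: hd; rewrite addrC addKr.
have cr := @Re_psi_continuous f v w Aw; have ci := @Im_psi_continuous f v w Aw.
pose a k := (2 * pi / N%:R * k%:R) *: (rr v : 'rV[R]_n).
have cg (g : 'rV[R]_n -> R) : continuous g -> continuous (fun x : 'rV[R]_n => N%:R^-1 * \sum_(k < N) g (x + a k)).
  move=> cg; apply: contM; first exact: contc.
  apply: (@sum_continuous _ _ _ _ _ (fun (k : 'I_N) (x : 'rV[R]_n) => g (x + a k))) => k _.
  apply: (cont_comp _ cg); apply: rV_continuous => i.
  rewrite (_ : (fun x => _) = fun x : 'rV[R]_n => x 0 i + a k 0 i); last first.
    by apply/funext => s; rewrite !mxE.
  by apply: contD; [exact: coord_continuous_rV|exact: contc].
split.
- rewrite -(@tmean_shifts (fun x => Re (psi f v w x)) N a)//; last first.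
    by move=> x j; rewrite psi_periodic.
  apply: tmean_near_cst => [|x]; first exact: (cg _ cr).
  by have [+ _] := key x; rewrite Re_psi_avg.
- rewrite -(@tmean_shifts (fun x => Im (psi f v w x)) N a)//; last first.
    by move=> x j; rewrite psi_periodic.
  apply: tmean_near_cst => [|x]; first exact: (cg _ ci).
  by have [_ +] := key x; rewrite Im_psi_avg.
Qed.

Lemma gsum_idot f v w th :
  gsum f (idot v) w th = \sum_j (v 0 j)%:~R * gsum f (idot (delta_mx 0 j)) w th.
Proof.
under eq_bigr do rewrite mulr_sumr.
rewrite exchange_big /=; apply: eq_bigr => al _.
rewrite /idot raddf_sum /= !mulr_suml; apply: eq_bigr => j _.
by rewrite -/(idot (delta_mx 0 j) al) idot_delta intrM !mulrA.
Qed.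

(** The linearity is that of [psi] in v, carried over by the torus mean. *)
Lemma wind_linear f v w th : ~ amoeba f w ->
  wind f v w th 0 = \sum_j (v 0 j)%:~R * wind f (delta_mx 0 j) w th 0.
Proof.
move=> Aw; rewrite -(tmean_psi v th th Aw).1.
rewrite (_ : (fun x => _) = fun x => \sum_j (v 0 j)%:~R * Re (psi f (delta_mx 0 j) w x)); last first.
  apply/funext => x; rewrite /psi gsum_idot mulr_suml Re_sum; apply: eq_bigr => j _.
  have -> : (v 0 j)%:~R = ((v 0 j)%:~R)%:C :> R[i] by rewrite rmorph_int.
  by rewrite -mulrA; case: (_ / _) => a b /=; rewrite mul0r subr0.
rewrite tmean_sum; last first.
  by move=> j; apply: contM; [exact: contc|exact: Re_psi_continuous].
apply: eq_bigr => j _; rewrite tmeanZ; last exact: Re_psi_continuous.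
by rewrite (tmean_psi _ _ th Aw).1.
Qed.

(** On a circle dz / z = i dt: each integration yields a factor 2 pi i and cancels one coordinate of
    the product. The denominator left consists of the coordinates not yet integrated. *)
Lemma iterated_circle_integral_mean f j w s (z : 'rV[R[i]]_n) th :
  ~ amoeba f w -> uniq s -> (forall k, k \notin s -> z 0 k = cis (w 0 k) (th 0 k)) ->
  iterated_circle_integral s (\row_k expR (w 0 k)) (fun z =>
    z 0 j * laurent_partial_eval j f z / laurent_eval f z / \prod_(k < n) z 0 k) z =
  (Complex 0 (2 * pi)) ^+ size s *
    Complex (tmean s (fun x => Re (psi f (delta_mx 0 j) w x)) th)
            (tmean s (fun x => Im (psi f (delta_mx 0 j) w x)) th)
    / \prod_(k < n | k \notin s) cis (w 0 k) (th 0 k).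
Proof.
move=> Aw.
pose G (z : 'rV[R[i]]_n) := z 0 j * laurent_partial_eval j f z / laurent_eval f z / \prod_(k < n) z 0 k.
rewrite -/G.
have cr := @Re_psi_continuous f (delta_mx 0 j) w Aw.
have ci := @Im_psi_continuous f (delta_mx 0 j) w Aw.
elim: s z th => [|i s ih] z th /=.
  move=> _ hz; have -> : z = tpt w th by apply/rowP => k; rewrite mxE hz.
  rewrite /G laurent_partial_tpt laurent_eval_tpt expr0 mul1r -/(psi f (delta_mx 0 j) w th).
  congr (_ / _); first by case: (psi _ _ _ _).
  by apply: eq_bigr => k _; rewrite mxE.
move=> /andP[iS us] hz.
pose X t := tmean s (fun x => Re (psi f (delta_mx 0 j) w x)) (upd th i t).
pose Y t := tmean s (fun x => Im (psi f (delta_mx 0 j) w x)) (upd th i t).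
pose Q := \prod_(k < n | k \notin i :: s) cis (w 0 k) (th 0 k).
pose c := (Complex 0 (2 * pi)) ^+ size s * Complex 0 1 / Q.
have e t : iterated_circle_integral s (\row_k expR (w 0 k)) G
     (set_coord z i (circle_point (expR (w 0 i)) t)) *
     (Complex 0 1 * circle_point (expR (w 0 i)) t) = c * Complex (X t) (Y t).
  rewrite (ih _ (upd th i t))//; last first.
    move=> k ks; rewrite !mxE; case: eqP => [->//|/eqP ki].
    by apply: hz; rewrite inE negb_or ki.
  rewrite -/(cis (w 0 i) t) (bigD1 i)//= mxE eqxx.
  rewrite (_ : \prod_(_ < n | _) _ = Q); last first.
    rewrite /Q; apply: eq_big => [k|k /andP[_ /negPf ki]]; first by rewrite inE negb_or andbC.
    by rewrite mxE ki.
  have Q0 : Q != 0 by apply/prodf_neq0 => k _; exact: cis_neq0.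
  have u0 := cis_neq0 (w 0 i) t.
  rewrite /c -/(X t) -/(Y t) {c}; clearbody Q; move: (_ ^+ _) (Complex 0 1) (Complex (X t) (Y t)) (cis _ _) Q u0 Q0.
  by move=> p q r u q0 u0 q00; field; rewrite u0 q00.
rewrite /circle_integral mxE.
have cX : continuous X by exact: tmean_upd_continuous.
have cY : continuous Y by exact: tmean_upd_continuous.
under eq_Rintegral do rewrite e.
under [X in Complex _ X]eq_Rintegral do rewrite e.
rewrite (_ : Complex _ _ = (2 * pi)%:C * (c * Complex (cmean X) (cmean Y))); last first.
  have iX := continuous_integrable 0 (2 * pi) cX.
  have iY := continuous_integrable 0 (2 * pi) cY.
  have [cx cy] : (cmean X = (2 * pi)^-1 * \int[lebesgue_measure]_(t in `[0, 2 * pi]) X t /\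
    cmean Y = (2 * pi)^-1 * \int[lebesgue_measure]_(t in `[0, 2 * pi]) Y t) by [].
  have tp : 2 * pi != 0 :> R by rewrite gt_eqF// twopi_gt0.
  have lin a b : \int[lebesgue_measure]_(t in `[0, 2 * pi]) (a * X t + b * Y t) =
      2 * pi * (a * cmean X + b * cmean Y).
    have caX : continuous (fun t => a * X t) by apply: contM; [exact: contc|].
    have cbY : continuous (fun t => b * Y t) by apply: contM; [exact: contc|].
    have := cmeanD caX cbY; rewrite !cmeanZ// => <-.
    by rewrite /cmean mulrA mulfV// mul1r.
  case: (c) => a b /=; apply/eqP; rewrite eq_complex /= !mul0r subr0 addr0.
  rewrite -mulNr -lin (addrC (a * cmean Y)) -lin; apply/andP; split; apply/eqP.
    by apply: eq_Rintegral => t _; rewrite mulNr.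
  by apply: eq_Rintegral => t _; rewrite addrC.
rewrite /c -/X -/Y exprS.
have -> : Complex 0 (2 * pi) = (2 * pi)%:C * Complex 0 1 :> R[i].
  by apply/eqP; rewrite eq_complex /= !mulr0 !mul0r mulr1 subrr addr0 !eqxx.
by rewrite /Q; move: (_ ^+ _) (_^-1) => p q; ring.
Qed.

Lemma order_integral_wind f w th j : ~ amoeba f w ->
  order_integral f w j = (wind f (delta_mx 0 j) w th 0)%:C.
Proof.
move=> Aw; rewrite /order_integral /torus_integral.
rewrite (iterated_circle_integral_mean (th := th) j Aw (enum_uniq _)); last first.
  by move=> k; rewrite mem_enum.
have [-> ->] := tmean_psi (delta_mx 0 j) th th Aw.
rewrite big_pred0 ?divr1; last by move=> k; rewrite mem_enum.
rewrite size_enum_ord mulKf// expf_neq0// eq_complex /= eqxx /=.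
by rewrite gt_eqF// twopi_gt0.
Qed.

(** Since winding numbers are integers, the witness [al] shows that [xget] makes a genuine choice
    rather than returning its default 0. *)
Lemma order_mapE f w th j : ~ amoeba f w ->
  (order_map f w 0 j)%:~R = wind f (delta_mx 0 j) w th 0.
Proof.
move=> Aw.
pose al : 'rV[int]_n := \row_j ((count (fun z => `|z| < (expR 0)%:C)
   (lroots f (delta_mx 0 j) w th))%:Z - (shift f (delta_mx 0 j))%:Z).
have h : [set al : 'rV[int]_n | forall j, (al 0 j)%:~R = order_integral f w j] al.
  by move=> k; rewrite (order_integral_wind th k Aw) mxE /wind intrB rmorphB /= !rmorph_nat.
have := xgetPex 0 (ex_intro _ al h) j; rewrite -/(order_map f w) (order_integral_wind th j Aw).
by rewrite -(rmorph_int (real_complex R)) => /complexI.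
Qed.

End OrderWinding.

(** * Order classes *)

Lemma count_lt (T : eqType) (s : seq T) (p q : pred T) x :
  (forall y, p y -> q y) -> x \in s -> q x -> ~~ p x -> (count p s < count q s)%N.
Proof.
move=> pq + qx px; elim: s => [//|y s ih]; rewrite inE /= => /predU1P[<-|xs].
  by rewrite qx (negPf px) add0n add1n ltnS; apply: sub_count => z; exact: pq.
rewrite -addnS; apply: leq_add; last exact: ih.
by case: (p y) (pq y) => [->|].
Qed.

Section OrderClasses.
Context {R : realType} {n : nat}.
Implicit Types (f : laurent R n) (w th x y : 'rV[R]_n) (v al : 'rV[int]_n) (E : set 'rV[R]_n).

Lemma line_continuous x y : continuous (fun t : R => x + t *: y).
Proof.
apply: rV_continuous => i; rewrite (_ : (fun t => _) = fun t => x 0 i + t * y 0 i); last first.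
  by apply/funext => s; rewrite !mxE.
by apply: contD; [exact: contc|apply: contM; [move=> s; exact: cvg_id|exact: contc]].
Qed.

Lemma connected_component_segment (A : set 'rV[R]_n) x y :
  (forall t, 0 <= t <= 1 -> A (x + t *: (y - x))) -> connected_component A x y.
Proof.
move=> h; pose B := (fun t : R => x + t *: (y - x)) @` `[0, 1].
apply: (@connected_component_max _ A B).
- by exists 0; rewrite /= ?in_itv /= ?lexx ?ler01 ?scale0r ?addr0.
- by move=> _ [t t01 <-]; apply: h; rewrite /= in_itv in t01.
- apply: connected_continuous_connected; first exact: segment_connected.
  exact/continuous_subspaceT/line_continuous.
- by exists 1; rewrite /= ?in_itv /= ?lexx ?ler01 ?scale1r ?(addrC x) ?subrK.
Qed.

Lemma order_locally_constant f w : ~ amoeba f w ->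
  \forall w' \near w, ~ amoeba f w' /\ order_map f w' = order_map f w.
Proof.
move=> Aw.
have nA : \forall w' \near w, ~ amoeba f w'.
  by apply: open_nbhs_nbhs; split => //; exact/closed_openC/amoeba_closed.
have nj j : \forall w' \near w, wind f (delta_mx 0 j) w' 0 0 = wind f (delta_mx 0 j) w 0 0.
  have c : continuous (fun w' : 'rV[R]_n => (w', 0 : 'rV[R]_n)).
    by apply: cont_pair; [move=> z; exact: cvg_id|exact: cst_continuous].
  exact: (c w _ (wind_locally_constant (delta_mx 0 j) 0 Aw)).
have nw : \forall w' \near w, forall j : 'I_n,
    wind f (delta_mx 0 j) w' 0 0 = wind f (delta_mx 0 j) w 0 0.
  by apply: (@filter_forall _ _ (fun j w' =>
    wind f (delta_mx 0 j) w' 0 0 = wind f (delta_mx 0 j) w 0 0) (nbhs w)); exact: nj.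
apply: filterS2 nA nw => w' Aw' h; split => //.
by apply/rowP => j; apply: (@intr_inj R); rewrite !(order_mapE 0)// h.
Qed.

Lemma wind_order f v w th : ~ amoeba f w ->
  wind f v w th 0 = (idot v (order_map f w))%:~R.
Proof.
move=> Aw; rewrite (wind_linear v th Aw) [RHS]raddf_sum; apply: eq_bigr => j _ /=.
by rewrite intrM (order_mapE th j Aw).
Qed.

(** Moving the base point along v rescales u. Both numbers are approximated by the same average
    [psi_avg f v (w + a *: rr v) th N]. *)
Lemma wind_radius f v w th (a : R) : ~ amoeba f (w + a *: rr v) ->
  wind f v (w + a *: rr v) th 0 = wind f v w th a.
Proof.
move=> Aw; have [d d0 hd] := complement_ball Aw.
have [eta eta0 heta] := @direction_scale R n v d d0.
have e4 : 0 < 4^-1 :> R by rewrite invr_gt0.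
have [N N0 hN] := psi_avg_uniform f v eta0 e4.
apply: wind_eq.
have [b|k1 _] := hN w th a.
  move=> hb; apply: hd; rewrite [X in `|X|](_ : _ = (b - a) *: rr v); first exact: heta.
  by rewrite opprD addrACA subrr add0r -scalerBl.
have [b|k2 _] := hN (w + a *: rr v) th 0.
  by rewrite subr0 => hb; apply: hd; rewrite addrAC subrr add0r; exact: heta.
rewrite scale0r addr0 in k2; move: k1 k2.
by rewrite !ler_norml !ltr_norml => /andP[? ?] /andP[? ?]; apply/andP; split; lra.
Qed.

(* After perturbing w and w' so that w' - w is parallel to an integer vector v,
   a point of the amoeba in between gives a zero of u |-> f (u ^ v . z) in an
   annulus that contains none, because the two winding numbers agree. *)
Lemma segment_avoids_amoeba f w w' t : ~ amoeba f w -> ~ amoeba f w' ->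
  order_map f w = order_map f w' -> 0 <= t <= 1 -> ~ amoeba f (w + t *: (w' - w)).
Proof.
move=> Aw Aw' e /andP[]; rewrite le_eqVlt => /predU1P[<- _|t0]; first by rewrite scale0r addr0.
rewrite le_eqVlt => /predU1P[->|t1]; first by rewrite scale1r addrC subrK.
set m := w + _ => Am.
have /nbhs_ballP [d1 /= d10 h1] := order_locally_constant Aw.
have /nbhs_ballP [d2 /= d20 h2] := order_locally_constant Aw'.
pose d := Num.min d1 d2; have d0 : 0 < d by rewrite lt_min d10.
have [N N0 hN] : exists2 N, (0 < N)%N & N%:R^-1 < d.
  exists (Num.trunc d^-1).+1 => //; rewrite -[ltRHS]invrK ltf_pV2 ?posrE ?invr_gt0 ?ltr0n//.
  exact: truncnS_gt.
have NR : 0 < N%:R :> R by rewrite ltr0n.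
(* Rounding at scale N: r = v / N is within 1 / N of w' - w in every coordinate. *)
pose v : 'rV[int]_n := \row_j Num.floor (N%:R * (w' - w) 0 j).
pose r : 'rV[R]_n := N%:R^-1 *: rr v.
have hr : `|r - (w' - w)| < d.
  have [->|] := eqVneq (r - (w' - w)) 0; first by rewrite normr0.
  rewrite -normr_eq0 => nz.
  have /mx_norm_neq0 [[i j] /= hij] : mx_norm (r - (w' - w)) != 0 := nz.
  rewrite (_ : `|_| = mx_norm (r - (w' - w)))// hij (ord1 i).
  apply: le_lt_trans hN; rewrite -[leRHS]mul1r ler_pdivlMr// -[X in _ * X]gtr0_norm// -normrM.
  rewrite /r /v !mxE mulrBl mulrAC mulVf ?gt_eqF// mul1r [_ * N%:R]mulrC.
  have /andP[k1 k2] := floor_itv (N%:R * (w' 0 j - w 0 j)).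
  rewrite intrD in k2; rewrite ler_norml; apply/andP; split; lra.
(* At these parameters the line through m along v passes near w and w', missing them by the
   fractions t and 1 - t of r - (w' - w). *)
pose a := - (t / N%:R); pose b := (1 - t) / N%:R.
have a0 : a < 0 by rewrite oppr_lt0 divr_gt0.
have b0 : 0 < b by rewrite divr_gt0// subr_gt0.
have E1 : m + a *: rr v = w - t *: (r - (w' - w)).
  by apply/rowP => j; rewrite /m /r /a /b !mxE; field; rewrite gt_eqF.
have E2 : m + b *: rr v = w' + (1 - t) *: (r - (w' - w)).
  by apply/rowP => j; rewrite /m /r /a /b !mxE; field; rewrite gt_eqF.
have [A1 o1] : ~ amoeba f (m + a *: rr v) /\ order_map f (m + a *: rr v) = order_map f w.
  apply: h1; rewrite -ball_normE /= E1 opprB addrC subrK normrZ gtr0_norm//.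
  apply: le_lt_trans (lt_le_trans hr _); last by rewrite ge_min lexx.
  by rewrite ler_piMl// ltW.
have [A2 o2] : ~ amoeba f (m + b *: rr v) /\ order_map f (m + b *: rr v) = order_map f w'.
  apply: h2; rewrite -ball_normE /= E2 opprD addrA subrr add0r normrN normrZ gtr0_norm ?subr_gt0//.
  apply: le_lt_trans (lt_le_trans hr _); last by rewrite ge_min lexx orbT.
  by rewrite ler_piMl// gerBl ltW.
have /amoebaP [th fm] := Am.
have P0 : lpoly f v m th != 0.
  apply: (@lpoly_neq0 _ _ f v m th a 0); exact: fval_neq0.
have : wind f v m th a = wind f v m th b.
  by rewrite -(wind_radius th A1) -(wind_radius th A2) (wind_order v th A1) (wind_order v th A2) o1 o2 e.
rewrite /wind => /addIr /eqP; rewrite eqr_nat; apply/negP; rewrite neq_ltn; apply/orP; left.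
(* The zero over m is the root u = 1, and e^a < 1 < e^b, so the larger disc counts at least one more
   root. *)
apply: (@count_lt _ _ _ _ (cis 0 0)).
- move=> z /lt_trans; apply; rewrite ltcR ltr_expR; exact: lt_trans b0.
- by rewrite mem_lroots// !scale0r !addr0 fm.
- by rewrite norm_cis ltcR ltr_expR.
- by rewrite norm_cis ltcR ltr_expR -leNgt ltW.
Qed.

Definition order_class f al : set 'rV[R]_n := [set w | ~ amoeba f w /\ order_map f w = al].

Lemma order_class_open f al : open (order_class f al).
Proof.
rewrite openE => w [Aw ow]; apply: filterS (order_locally_constant Aw) => w' [].
by rewrite ow.
Qed.

Lemma order_class_segment f al x y t : order_class f al x -> order_class f al y ->
  0 <= t <= 1 -> order_class f al (x + t *: (y - x)).
Proof.
move=> [Ax ox] [Ay oy] t01.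
have h s : 0 <= s <= 1 -> ~ amoeba f (x + s *: (y - x)).
  by apply: segment_avoids_amoeba => //; rewrite ox oy.
split; first exact: h.
pose g s := order_map f (x + s *: (y - x)).
rewrite -ox (_ : order_map f x = g 0); last by rewrite /g scale0r addr0.
rewrite -/(g t); apply: (locally_constant_connected (@segment_connected R 0 1)).
- move=> s; rewrite /= in_itv /= => /h /order_locally_constant hs.
  have hs' : \forall u \near s, ~ amoeba f (x + u *: (y - x)) /\ g u = g s.
    exact: (@line_continuous x (y - x) s _ hs).
  by apply: filterS hs' => u [].
- by rewrite /= in_itv.
- by rewrite /= in_itv /= lexx ler01.
Qed.

Lemma order_class_convex f al : @convex_set R 'rV[R]_n (order_class f al).
Proof.
apply/convex_setP => x y t Ox Oy t01.
have -> : t *: x + (1 - t) *: y = y + t *: (x - y).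
  by apply/rowP => j; rewrite !mxE; ring.
exact: order_class_segment.
Qed.

(** A locally constant order is constant on a component; conversely, a class contains the segment
    from w to each of its points. *)
Lemma component_order_class f w : ~ amoeba f w ->
  connected_component (~` amoeba f) w = order_class f (order_map f w).
Proof.
move=> Aw; apply/seteqP; split => [x cx|x [Ax ox]].
  have Ax := connected_component_sub cx; split => //.
  apply: (locally_constant_connected (@component_connected _ (~` amoeba f) w)) => //.
    by move=> y /connected_component_sub /order_locally_constant; apply: filterS => z [].
  exact: (@connected_component_refl _ (~` amoeba f) w Aw).
apply: connected_component_segment => t t01.
by have [] : order_class f (order_map f w) (w + t *: (x - w)) by exact: order_class_segment.
Qed.

Lemma complement_componentP f E : complement_component f E <->
  exists2 al, E = order_class f al & E !=set0.
Proof.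
split=> [[w Aw ->]|[al -> [w [Aw ow]]]].
  exists (order_map f w); first exact: component_order_class.
  by exists w; exact: (@connected_component_refl _ (~` amoeba f) w Aw).
by exists w => //; rewrite component_order_class// ow.
Qed.

(** The order is a number of roots between 0 and twice [shift], minus [shift]. This bound makes the
    set of orders finite. *)
Lemma order_map_bounded f w (j : 'I_n) : ~ amoeba f w ->
  (absz (order_map f w 0%R j) <= shift f (delta_mx 0%R j))%N.
Proof.
move=> Aw; have := order_mapE (0 : 'rV[R]_n) j Aw.
have P0 : lpoly f (delta_mx 0 j) w 0 != 0.
  apply: (@lpoly_neq0 _ _ f _ w 0 0 0); rewrite !scale0r !addr0; exact: fval_neq0.
have hs := size_lroots P0; rewrite /wind; set c := count _ _.
have hc : (c <= (shift f (delta_mx 0%R j)).*2)%N by apply: leq_trans hs; exact: count_size.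
move: (shift f _) hc => S hc e.
have {}e : order_map f w 0 j = c%:Z - S%:Z.
  by apply: (@intr_inj R); rewrite e intrB.
by rewrite e; lia.
Qed.

(* Finitely many orders occur, so only classes having p in their closure meet
   a small neighbourhood of p. *)
Lemma order_class_locally_finite f (p : 'rV[R]_n) :
  \forall u \near p, ~ amoeba f u -> closure (order_class f (order_map f u)) p.
Proof.
pose S := (\sum_(j < n) shift f (delta_mx 0%R j))%N.
(* A finite type enumerating the integer points of [-S, S]^n, so that finitely many neighbourhoods
   can be intersected. *)
pose al (k : {ffun 'I_n -> 'I_(S.*2).+1}) : 'rV[int]_n := \row_j ((k j)%:Z - S%:Z).
have h : \forall u \near p, forall k, closure (order_class f (al k)) u ->
    closure (order_class f (al k)) p.
  apply: (@filter_forall _ _ (fun k u => closure (order_class f (al k)) u ->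
    closure (order_class f (al k)) p) (nbhs p)) => k.
  have [cp|cp] := pselect (closure (order_class f (al k)) p); first by apply: nearW.
  have : nbhs p (~` closure (order_class f (al k))).
    by apply: open_nbhs_nbhs; split => //; exact/closed_openC/closed_closure.
  by apply: filterS => u.
apply: filterS h => u hu Au.
have [k ek] : exists k, order_map f u = al k.
  have b j : (absz (order_map f u 0%R j + S%:Z)%R < (S.*2).+1)%N.
    have := order_map_bounded j Au.
    have : (shift f (delta_mx 0%R j) <= S)%N by rewrite /S (bigD1 j)//= leq_addr.
    by lia.
  exists [ffun j => Ordinal (b j)]; apply/rowP => j; rewrite mxE ffunE /=.
  have := order_map_bounded j Au.
  have : (shift f (delta_mx 0%R j) <= S)%N by rewrite /S (bigD1 j)//= leq_addr.
  by lia.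
by rewrite ek; apply: hu; rewrite -ek; apply: subset_closure.
Qed.

(** By local finiteness, a class met near p has p in its closure, so it must be E. *)
Lemma near_adjacent f p E :
  (forall E', adjacent_component f p E' -> E' = E) ->
  \forall u \near p, amoeba f u \/ E u.
Proof.
move=> uE; apply: filterS (order_class_locally_finite f p) => u hu.
have [|Au] := pselect (amoeba f u); first by left.
right; have <- // : order_class f (order_map f u) = E.
apply: uE; split; last exact: hu.
by apply/complement_componentP; exists (order_map f u) => //; exists u.
Qed.

End OrderClasses.

(** * The intersection polytope *)

Section Systems.
Context {R : realType} {n : nat}.
Implicit Types (f : laurent R n) (F : 'I_n -> laurent R n) (p q m x y d : 'rV[R]_n).

Lemma boundary_closed (A : set 'rV[R]_n) : closed (boundary A).
Proof.
rewrite /boundary setDE; apply: closedI; first exact: closed_closure.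
exact/open_closedC/open_interior.
Qed.

Lemma nbhs_segment (P : set 'rV[R]_n) m d : nbhs m P ->
  exists2 e : R, 0 < e & forall t, `|t| <= e -> P (m + t *: d).
Proof.
move=> /nbhs_ballP [r /= r0 hr].
have c0 : 0 < `|d| + 1 by rewrite ltr_wpDl.
exists (r / (`|d| + 1) / 2); first by rewrite !divr_gt0.
move=> t ht; apply: hr; rewrite -ball_normE /= opprD addrA subrr add0r normrN normrZ.
have h : `|t| < r / (`|d| + 1) by apply: le_lt_trans ht _; have := divr_gt0 r0 c0; lra.
apply: (@le_lt_trans _ _ (`|t| * (`|d| + 1))); first by rewrite ler_wpM2l// lerDl.
by rewrite -ltr_pdivlMr.
Qed.

(* Near a boundary point the complement of the amoeba is one convex component,
   hence the amoeba contains a half-space germ. *)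
Lemma amoeba_halfspace f m : amoeba f m ->
  (boundary (amoeba f) m -> exists! E, adjacent_component f m E) ->
  exists u : 'rV[R]_n, \forall x \near m, 0 <= dot u (x - m) -> amoeba f x.
Proof.
move=> Am hE; have [bm|nbm] := pselect (boundary (amoeba f) m); last first.
  (* At an interior point the zero functional cuts nothing off: the half-space is the whole
     space. *)
  exists 0; have : (amoeba f)° m.
    by apply: contrapT => im; apply: nbm; split => //; exact: subset_closure.
  by apply: filterS.
have [E [[cE clE] uE]] := hE bm.
have [al eE _] := iffLR (complement_componentP f E) cE.
have Em : ~ E m by rewrite eE => -[].
have [||u hu] := supporting_functional _ _ Em.
- by rewrite eE; exact: order_class_open.
- by rewrite eE; exact: order_class_convex.
exists u; have /near_adjacent : forall E', adjacent_component f m E' -> E' = E.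
  by move=> E' /uE.
by apply: filterS => x [//|/hu]; rewrite ltNge => /negP.
Qed.

(** A zero column makes the n by n matrix of the functionals singular. *)
Lemma common_kernel (u : 'I_n -> 'rV[R]_n) (i : 'I_n) : u i = 0 ->
  exists2 d : 'rV[R]_n, d != 0 & forall l, dot (u l) d = 0.
Proof.
move=> ui; pose U : 'M[R]_n := \matrix_(k, l) u l 0 k.
have : kermx U != 0.
  rewrite kermx_eq0 row_free_unit unitmxE unitfE negbK.
  rewrite (expand_det_col _ i) big1// => k _.
  by rewrite mxE ui mxE mul0r.
move=> /rowV0Pn [d /sub_kermxP dU d0]; exists d => // l.
have := congr1 (fun M : 'rV[R]_n => M 0 l) dU; rewrite !mxE => h.
by rewrite -[RHS]h; apply: eq_bigr => k _; rewrite mxE mulrC.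
Qed.

Lemma segment_in_component (X K : set 'rV[R]_n) m d : connected_component_of X K ->
  K m -> (forall t, 0 <= t <= 1 -> X (m + t *: d)) -> K (m + d).
Proof.
move=> [x0 _ ->] Km h; apply: connected_component_trans Km _.
apply: connected_component_segment => t t01.
by rewrite (addrC m d) addrK; exact: h.
Qed.

Lemma component_sub_hull F (K : set 'rV[R]_n) : generic_system F ->
  compact (amoeba_intersection F) -> connected_component_of (amoeba_intersection F) K ->
  K `<=` intersection_polytope F K.
Proof.
move=> [_ _ gen] cX cK.
have clX : closed (amoeba_intersection F) by apply: closed_bigI => i _; exact: amoeba_closed.
have KX : K `<=` amoeba_intersection F.
  by case: cK => x0 _ ->; exact: connected_component_sub.
have clK : closed K by case: cK => x0 _ ->; exact: component_closed.
have compK : compact K by apply: subclosed_compact KX.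
apply: sub_hull_of_segments => //.
  apply: subclosed_compact compK _; last exact: subIsetl.
  by apply: closedI => //; apply: closed_bigI => i _; exact: boundary_closed.
move=> m Km Vm; have Xm := KX m Km.
have [i bi] : exists i, ~ boundary (amoeba (F i)) m.
  by apply: contrapT => /forallNP h; apply: Vm; split => // i _; apply: contrapT; exact: h.
(* At the index i, whose amoeba has m in its interior, the functional is forced to be 0, as
   [common_kernel] requires. *)
have hu l : exists u : 'rV[R]_n, (l = i -> u = 0) /\
    \forall x \near m, 0 <= dot u (x - m) -> amoeba (F l) x.
  have [->|li] := eqVneq l i.
    exists 0; split => //; have : (amoeba (F i))° m.
      apply: contrapT => im; apply: bi; split => //; apply: subset_closure; exact: Xm.
    by apply: filterS.
  have [u uP] := @amoeba_halfspace (F l) m (Xm l I) (gen m l Xm).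
  by exists u; split => // e; rewrite e eqxx in li.
have /choice [u uP] := hu.
have [d d0 ud] := @common_kernel u i (proj1 (uP i) erefl).
have : nbhs m (fun x => forall l, 0 <= dot (u l) (x - m) -> amoeba (F l) x).
  apply: (@filter_forall _ _ (fun l x => 0 <= dot (u l) (x - m) -> amoeba (F l) x) (nbhs m)) => l.
  by have [] := uP l.
move=> /(@nbhs_segment _ m d) [e e0 he].
(* As d is orthogonal to every functional, both directions along d satisfy all the half-space
   conditions, with equality. *)
have Xd t : `|t| <= e -> amoeba_intersection F (m + t *: d).
  move=> /he h l _; apply: h.
  by rewrite addrAC subrr add0r dotZr ud mulr0.
exists (e *: d); split; first by rewrite scaler_eq0 negb_or d0 gt_eqF.
- apply: (segment_in_component cK Km) => t /andP[t0 t1]; rewrite scalerA; apply: Xd.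
  by rewrite ger0_norm ?mulr_ge0 ?(ltW e0)// ler_piMl// ltW.
- apply: (segment_in_component cK Km) => t /andP[t0 t1]; rewrite -scaleNr scalerA; apply: Xd.
  by rewrite mulrN normrN ger0_norm ?mulr_ge0 ?(ltW e0)// ler_piMl// ltW.
Qed.

(** The order recovers the adjacent component; this is how equal orders at p and q yield the same
    convex sets. *)
Lemma generalized_orderP f p E : amoeba f p -> adjacent_component f p E ->
  (forall E', adjacent_component f p E' -> E' = E) ->
  E = order_class f (generalized_order f p).
Proof.
move=> Ap aE uE; have [al eE E0] := iffLR (complement_componentP f E) aE.1.
have h : [set al | exists E0, [/\ adjacent_component f p E0,
    forall E', adjacent_component f p E' -> E' = E0 & component_of_order f al E0]] al.
  exists E; split => //.
  by split; [exact: aE.1|rewrite eE => w []].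
have [E1 [/uE -> _ [_ ho]]] := xgetPex 0 (ex_intro _ al h).
rewrite /generalized_order; case: asboolP => // _.
have [w Ew] := E0; have <- := ho w Ew.
by move: Ew; rewrite eE => -[_ ->].
Qed.

(* A prolonged point in the open convex set E would put p, which lies between it
   and q, in E. *)
Lemma prolong_in_amoeba f p q E : amoeba f p -> adjacent_component f p E ->
  (forall E', adjacent_component f p E' -> E' = E) -> closure E q ->
  exists2 e : R, 0 < e & forall t, 0 <= t <= e -> amoeba f (p + t *: (p - q)).
Proof.
move=> Ap [cE _] uE qE; have [al eE _] := iffLR (complement_componentP f E) cE.
have [e e0 he] := nbhs_segment (p - q) (near_adjacent uE).
exists e => // t /andP[t0 te].
have tn : `|t| <= e by rewrite ger0_norm.
have [//|Et] := he t tn.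
have s0 : 0 < 1 + t by rewrite ltr_wpDr.
have : E p.
  have -> : p = (1 + t)^-1 *: (p + t *: (p - q)) + (1 - (1 + t)^-1) *: q.
    by apply/rowP => j; rewrite !mxE; field; rewrite gt_eqF.
  apply: open_convex_segment => //.
  - by rewrite eE; exact: order_class_open.
  - by rewrite eE; exact: order_class_convex.
  - by rewrite invr_gt0 s0 invf_le1//= lerDl.
by rewrite eE => -[].
Qed.

Lemma system_order_extreme_inj F (K : set 'rV[R]_n) p q : generic_system F ->
  compact (amoeba_intersection F) -> connected_component_of (amoeba_intersection F) K ->
  extreme_points (intersection_polytope F K) p ->
  extreme_points (intersection_polytope F K) q ->
  system_order F p = system_order F q -> p = q.
Proof.
move=> gF cX cK ep eq e.
have [Kp Vp] := extreme_points_hull ep; have [Kq Vq] := extreme_points_hull eq.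
have KX : K `<=` amoeba_intersection F.
  by case: cK => x0 _ ->; exact: connected_component_sub.
have hprol i : exists2 e : R, 0 < e &
    forall t, 0 <= t <= e -> amoeba (F i) (p + t *: (p - q)).
  have [_ _ gen] := gF.
  have [E [aE uE]] := gen p i (KX p Kp) (Vp i I).
  have [E' [aE' uE']] := gen q i (KX q Kq) (Vq i I).
  have Ap := KX p Kp i I; have Aq := KX q Kq i I.
  have uE2 E0 : adjacent_component (F i) p E0 -> E0 = E by move/uE.
  have uE2' E0 : adjacent_component (F i) q E0 -> E0 = E' by move/uE'.
  apply: (prolong_in_amoeba Ap aE uE2).
  have -> : E = E'.
    rewrite (generalized_orderP Ap aE uE2) (generalized_orderP Aq aE' uE2').
    congr order_class; apply/rowP => j.
    by have := congr1 (fun M : 'M[int]_n => M i j) e; rewrite !mxE.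
  exact: aE'.2.
have [ep0 ep0_gt hep] : exists2 e : R, 0 < e &
    forall i t, 0 <= t <= e -> amoeba (F i) (p + t *: (p - q)).
  have hc i : exists e : R, 0 < e /\ forall t, 0 <= t <= e -> amoeba (F i) (p + t *: (p - q)).
    by have [e0 ? ?] := hprol i; exists e0.
  have /choice [g gP] := hc.
  (* A common length for all the amoebas; the unit 1 keeps the minimum positive. *)
  exists (\big[Num.min/1]_i g i).
    by elim/big_ind: _ => // [x y x0 y0|i _]; [rewrite lt_min x0|case: (gP i)].
  move=> i t /andP[t0 te]; apply: (gP i).2; rewrite t0 /=; apply: le_trans te _.
  exact: bigmin_le_cond.
have Ky : K (p + ep0 *: (p - q)).
  apply: (segment_in_component cK Kp) => t /andP[t0 t1] i _.
  rewrite scalerA; apply: hep; rewrite mulr_ge0 ?(ltW ep0_gt)//=.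
  by rewrite ler_piMl// ltW.
have Qy := component_sub_hull gF cX cK Ky.
have s0 : 0 < 1 + ep0 by rewrite addr_gt0.
(* The point p is a proper convex combination of the prolonged point and q, both in the polytope.
   Extremality makes them equal, whence (1 + ep0) (p - q) = 0. *)
have yq : p + ep0 *: (p - q) = q.
  apply: (ep.2 _ _ (1 + ep0)^-1 Qy eq.1).
    by rewrite invr_gt0 s0 invf_lt1//= ltrDl.
  by apply/rowP => j; rewrite !mxE; field; rewrite gt_eqF.
apply/eqP; rewrite -subr_eq0.
have : (1 + ep0) *: (p - q) = 0 by rewrite scalerDl scale1r addrAC yq subrr.
by move=> /eqP; rewrite scaler_eq0 gt_eqF.
Qed.

End Systems.

Theorem theorem4p1 (R : realType) (n : nat) (n_ge2 : (2 <= n)%N)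
    (A : 'I_n -> {fset 'rV[int]_n}) (F : 'I_n -> laurent R n)
    (F_supp : forall i, finsupp (F i) = A i)
    (F_generic : generic_system F)
    (F_compact : compact (amoeba_intersection F))
    (K : set 'rV[R]_n)
    (K_component : connected_component_of (amoeba_intersection F) K) :
  (forall p q : 'rV[R]_n,
     extreme_points (intersection_polytope F K) p ->
     extreme_points (intersection_polytope F K) q ->
     p <> q -> system_order F p <> system_order F q)
  /\ {in extreme_points (intersection_polytope F K) &,
       injective (system_order F)}.
Proof.
split=> [p q ep eq pq e|p q /set_mem ep /set_mem eq].
  by apply: pq; exact: (system_order_extreme_inj F_generic F_compact K_component).
exact: (system_order_extreme_inj F_generic F_compact K_component).
Qed.
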